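(* For $\lambda=(\lambda_k)_{k\ge1}\in(0,1)^{\mathbb N}$ let $\mathscr{C}_\lambda\subset[0,1]$ be the associated central Cantor set. (i) For every $\lambda\in(0,1)^{\mathbb N}$, $$\Delta(\mathscr{C}_\lambda,\varepsilon)\preccurlyeq\big(\log(\varepsilon^{-1})\big)^2 .$$ (ii) Suppose moreover that $(\lambda_k)_{k\ge1}$ are independent identically distributed random variables with values in $(0,1)$ whose common distribution is absolutely continuous with a density $f$ on $(0,1)$ that is bounded above and bounded below away from zero. Then for every $\delta>0$, $$\big(\log(\varepsilon^{-1})\big)^{2-\delta}\preccurlyeq\Delta(\mathscr{C}_\lambda,\varepsilon)$$ for almost every $\lambda\in(0,1)^{\mathbb N}$. Here $f\preccurlyeq g$ means that there is a constant $C>0$ such that $f(\varepsilon)\le C g(\varepsilon)$ for all sufficiently small $\varepsilon>0$ (the constant and the threshold on $\varepsilon$ may depend on $\lambda$ and $\delta$).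
   Context: Complexity. Fix a universal Turing machine $U$. A program is a finite binary word $\mathtt P\in\{0,1\}^*$ run on $U$, with length $\ell(\mathtt P)$; when it halts, its output is read (in a fixed standard encoding, e.g. as a finite list of points with rational coordinates) as a finite set $\mathtt C(\mathtt P)\subset\mathbb R$. For a compact set $\mathscr{C}\subset\mathbb R$ and $\varepsilon>0$, the $\varepsilon$-distortion complexity is $$\Delta(\mathscr{C},\varepsilon)=\min\{\ell(\mathtt P) : d_{\mathrm H}(\mathtt C(\mathtt P),\mathscr{C})<\varepsilon\},$$ where the minimum is over programs producing a finite set and $d_{\mathrm H}$ is the Hausdorff distance, $d_{\mathrm H}(F_1,F_2)=\max\{\sup_{x\in F_2}d(x,F_1),\sup_{x\in F_1}d(x,F_2)\}$. Central Cantor sets. Given $\lambda=(\lambda_k)_{k\ge1}\in(0,1)^{\mathbb N}$, set $C^0_\lambda=[0,1]$. Inductively, $C^k_\lambda$ is a disjoint union of $2^k$ closed intervals $J^k_1(\lambda),\dots,J^k_{2^k}(\lambda)$ of equal length, and $C^{k+1}_\lambda$ is obtained by deleting from each $J^k_i(\lambda)$ the open interval with the same centre and of length $(1-\lambda_{k+1})|J^k_i(\lambda)|$, which leaves $2^{k+1}$ closed intervals, each of length $2^{-(k+1)}\prod_{h=1}^{k+1}\lambda_h$. For instance $C^1_\lambda=[0,\lambda_1/2]\cup[1-\lambda_1/2,1]$. Then $\mathscr{C}_\lambda=\bigcap_{k\ge0}C^k_\lambda$. When the $\lambda_k$ are i.i.d. random variables, $(0,1)^{\mathbb N}$ carries the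 product probability measure and ''almost every $\lambda$'' refers to it. *)

(* Defs.v *)
From HB Require Import structures.
From mathcomp Require Import all_boot all_order all_algebra.
From mathcomp Require Import all_classical all_reals all_analysis.

Set Implicit Arguments.
Unset Strict Implicit.
Unset Printing Implicit Defensive.

Import Order.TTheory GRing.Theory Num.Theory.
Import numFieldNormedType.Exports.

Local Open Scope classical_set_scope.
Local Open Scope ring_scope.

Definition word := seq bool.

Inductive tm_move := MoveLeft | Stay | MoveRight.

(** Deterministic machines with [tm_aux.+1] tapes (so one or more). The tape
    alphabet is [option (bool + tm_extra)]: [None] is the blank, the bits are
    the input/output symbols, [tm_extra] holds the remaining working symbols.
    The machine halts when [tm_delta] returns [None]. *)
Record turing_machine := TuringMachine {
  tm_state : finType;
  tm_extra : finType;
  tm_aux : nat;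
  tm_start : tm_state;
  tm_delta : tm_state -> {ffun 'I_tm_aux.+1 -> option (bool + tm_extra)} ->
    option (tm_state *
            {ffun 'I_tm_aux.+1 -> option (bool + tm_extra) * tm_move})
}.

Section Execution.
Variable M : turing_machine.

Let sym := option (bool + tm_extra M).

(** A tape is infinite in both directions: the cells to the left of the head
    (nearest first), the cell under the head, the cells to the right (nearest
    first); all cells not listed are blank. *)
Record tape := Tape { tape_left : seq sym; tape_head : sym; tape_right : seq sym }.

Definition tape_write (a : sym) (t : tape) :=
  Tape (tape_left t) a (tape_right t).

Definition tape_move (m : tm_move) (t : tape) :=
  match m with
  | MoveLeft => Tape (behead (tape_left t)) (head None (tape_left t))
                     (tape_head t :: tape_right t)
  | Stay => t
  | MoveRight => Tape (tape_head t :: tape_left t) (head None (tape_right t))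
                      (behead (tape_right t))
  end.

Record config := Config {
  conf_state : tm_state M;
  conf_tapes : {ffun 'I_(tm_aux M).+1 -> tape}
}.

Definition tm_step (c : config) : option config :=
  if @tm_delta M (conf_state c) [ffun i => tape_head (conf_tapes c i)]
     is Some (q, a) then
    Some (Config q [ffun i => tape_move (a i).2
                                (tape_write (a i).1 (conf_tapes c i))])
  else None.

(** The halting configuration reached from [c] in at most [n] steps, if any. *)
Fixpoint tm_run (n : nat) (c : config) : option config :=
  match tm_step c with
  | None => Some c
  | Some c' => if n is n'.+1 then tm_run n' c' else None
  end.

Definition input_tape (w : word) : tape :=
  let s := [seq Some (inl b) : sym | b <- w] in
  Tape [::] (head None s) (behead s).

Definition blank_tape : tape := Tape [::] None [::].

Definition tm_init (w : word) : config :=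
  Config (tm_start M)
    [ffun i => if i == ord0 then input_tape w else blank_tape].

Fixpoint leading_bits (s : seq sym) : word :=
  if s is Some (inl b) :: s' then b :: leading_bits s' else [::].

(** Input and output are both on the first tape; the output is the longest
    block of bits starting at the head. *)
Definition conf_output (c : config) : word :=
  leading_bits (tape_head (conf_tapes c ord0) :: tape_right (conf_tapes c ord0)).

(** [M], run on [w], halts with output [v]. *)
Definition tm_computes (w v : word) : Prop :=
  exists n c, tm_run n (tm_init w) = Some c /\ conf_output c = v.

End Execution.

(** [U] simulates every machine [M] on every input [w], once a code of [M]
    (not depending on [w]) is put in front of [w]. *)
Definition universal (U : turing_machine) : Prop :=
  forall M : turing_machine, exists code : word,
    forall w v : word, tm_computes U (code ++ w) v <-> tm_computes M w v.

(** Sign bit ([true] for negative), and binary numerals, most significant bit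
    first, of the numerator and of the denominator; the fraction need not be
    in lowest terms. *)
Definition fraction := (bool * word * word)%type.

Definition nat_of_bits (s : word) : nat :=
  foldl (fun (n : nat) (b : bool) => (n.*2 + b)%N) 0%N s.

Definition fraction_ok (x : fraction) : bool := (0 < nat_of_bits x.2)%N.

Definition rat_of_fraction (x : fraction) : rat :=
  (-1) ^+ x.1.1 * ((nat_of_bits x.1.2)%:R / (nat_of_bits x.2)%:R).

(** Self-delimiting: each bit is preceded by the marker 1, and 0 ends the
    numeral. *)
Definition encode_bits (s : word) : word :=
  flatten [seq [:: true; b] | b <- s] ++ [:: false].

Definition encode_fraction (x : fraction) : word :=
  x.1.1 :: encode_bits x.1.2 ++ encode_bits x.2.

Definition produces (U : turing_machine) (p : word) (F : seq rat) : Prop :=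
  exists s : seq fraction,
    [/\ tm_computes U p (flatten [seq encode_fraction x | x <- s]),
        all fraction_ok s & F = [seq rat_of_fraction x | x <- s]].

Section Complexity.
Variable R : realType.

(** Extended-real valued; the distance from the empty set to a nonempty set
    is [+oo]. *)
Definition hausdorff_dist (A B : set R) : \bar R :=
  maxe (ereal_sup [set edist_inf A x | x in B])
       (ereal_sup [set edist_inf B x | x in A]).

Definition points (F : seq rat) : set R := [set ratr q | q in [set` F]].

(** The infimum of a set of natural numbers, hence a minimum as soon as there
    is such a program (and [+oo] otherwise). *)
Definition Delta (U : turing_machine) (K : set R) (eps : R) : \bar R :=
  ereal_inf [set ((size p)%:R)%:E | p in
    [set p : word | exists F : seq rat,
       produces U p F /\ (hausdorff_dist (points F) K < eps%:E)%E]].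

Definition preccurlyeq (f g : R -> \bar R) : Prop :=
  exists2 C : R, 0 < C & \forall eps \near 0^'+, (f eps <= C%:E * g eps)%E.

Definition remove_middle (l : R) (J : R * R) : seq (R * R) :=
  let centre := (J.1 + J.2) / 2 in
  let gap := (1 - l) * (J.2 - J.1) in
  [:: (J.1, centre - gap / 2); (centre + gap / 2, J.2)].

(** The sequence is indexed from 0: [lam k] is lambda_{k+1}. *)
Fixpoint cantor_intervals (lam : nat -> R) (k : nat) : seq (R * R) :=
  if k is k'.+1 then
    flatten [seq remove_middle (lam k') J | J <- cantor_intervals lam k']
  else [:: (0, 1)].

Definition cantor_level (lam : nat -> R) (k : nat) : set R :=
  \bigcup_(J in [set` cantor_intervals lam k]) `[J.1, J.2]%classic.

Definition central_cantor (lam : nat -> R) : set R :=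
  \bigcap_k cantor_level lam k.

End Complexity.

Definition mutually_independent d (Omega : measurableType d) (R : realType)
    (P : probability Omega R) (X : nat -> {RV P >-> R}) : Prop :=
  forall (I : seq nat) (A : nat -> set R),
    uniq I -> (forall k, measurable (A k)) ->
    P (\bigcap_(k in [set` I]) (X k @^-1` A k)) =
      (\prod_(k <- I) P (X k @^-1` A k))%E.

Definition has_density01 d (Omega : measurableType d) (R : realType)
    (P : probability Omega R) (X : {RV P >-> R}) (f : R -> R) : Prop :=
  (forall w, 0 < X w < 1) /\
  (forall A : set R, measurable A ->
     distribution P X A =
       (\int[lebesgue_measure]_(x in A `&` `]0%R, 1%R[%classic) (f x)%:E)%E).

(* Main.v *)
(** The set of subset sums of the shifts a_k = l_(k-1) - l_k, where l_k is the
    length of the intervals of level k, is the set of left endpoints of a level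
    of the construction.  Upper bound: with N of order log(1/eps), the N shifts
    truncated to 2N binary digits form an input of O(N^2) bits for an explicit
    three-tape machine which prints all 2^N subset sums.

    Lower bound: along the leftmost chain of intervals, a Hausdorff-small
    perturbation of the set moves l_k by little, since l_k belongs to the set
    and lies next to a gap.  Hence one finite output confines n coordinates
    lambda_k to a box of small volume, and a union bound over the short programs
    is summable along the scales eps_j = 2^(-(2q+4) j^q) with n = j^(q-1). *)
Require Import Defs.
From HB Require Import structures.
From mathcomp Require Import all_boot all_order all_algebra.
From mathcomp Require Import all_classical all_reals all_analysis.
From mathcomp Require Import zify ring lra.

Import Order.TTheory GRing.Theory Num.Theory.
Import numFieldNormedType.Exports.

Local Open Scope classical_set_scope.
Local Open Scope ring_scope.

Set Implicit Arguments.
Unset Strict Implicit.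
Unset Printing Implicit Defensive.

(** * A machine printing all subset sums *)

(** Upper bound: running time and the size of the output cost nothing, so printing 2^N points costs
    only the description of N shifts; l_N <= 2^(-N) holds for every sequence, whence N of order
    log(1/eps) whatever the ratios are.

    Lower bound: the obstacle is that ratios close to 0 shrink the intervals and ratios close to 1
    shrink the gaps. Keeping the first n ratios in [2^(-qj), 1 - 2^(-qj)] fails with probability
    O(2^(-j)), but only guarantees l_n >= 2^(-(qj+1)n). With Q = j^q and n = j^(q-1) one has nj = Q,
    so this loss is comparable with log(1/eps); the price is n = Q^(1-1/q) instead of Q. There are
    at most 2^(nQ+1) programs of length at most nQ, each with a box of probability at most (2M
    2^(-2Q))^n, and nQ is of order log(1/eps)^(2-1/q), so 1/q <= delta is what is needed.

    A box is not read off the output: its centre is the ratio vector of one typical sample point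
    whose set is approximated by that output. *)

Section Reachability.
Variable M : turing_machine.

(** [tm_run] returns only halting configurations, so an intermediate one is described by its effect
    on every remaining budget [k]; composition is then addition of step counts. *)
Definition reaches (c c' : config M) :=
  exists n, forall k, tm_run (n + k) c = tm_run k c'.

Lemma reaches_refl c : reaches c c.
Proof. by exists 0%N. Qed.

Lemma reaches_trans c1 c2 c3 : reaches c1 c2 -> reaches c2 c3 -> reaches c1 c3.
Proof.
move=> [n1 h1] [n2 h2]; exists (n1 + n2)%N => k.
by rewrite -addnA h1 h2.
Qed.

Lemma reaches_step c1 c2 c3 :
  tm_step c1 = Some c2 -> reaches c2 c3 -> reaches c1 c3.
Proof.
move=> h; apply: reaches_trans; exists 1%N => k.
by rewrite add1n /= h.
Qed.

Lemma reaches_computes c w :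
  reaches (tm_init M w) c -> tm_step c = None ->
  tm_computes M w (conf_output c).
Proof.
move=> [n h] hc; exists (n + 0)%N, c; split=> //.
by rewrite h /= hc.
Qed.

Lemma tm_run_mono n k (c c' : config M) :
  tm_run n c = Some c' -> tm_run (n + k) c = Some c'.
Proof.
elim: n c => [|n IH] c /=.
  by case: k => [|k] //=; case: (tm_step c).
by case: (tm_step c) => // c1; exact: IH.
Qed.

Lemma tm_computes_inj w v v' :
  tm_computes M w v -> tm_computes M w v' -> v = v'.
Proof.
move=> [n [c [hn <-]]] [n' [c' [hn' <-]]].
have := tm_run_mono n' hn; have := tm_run_mono n hn'.
by rewrite addnC => -> [->].
Qed.

(** In [rt] and [lt], [s] lists the cells from the head on in the direction of the sweep, rightwards
    or leftwards, so that a sweep consumes [s] as a list. *)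
Definition rt (l s : seq (option (bool + tm_extra M))) : tape M :=
  Tape l (head None s) (behead s).

Definition lt (s r : seq (option (bool + tm_extra M))) : tape M :=
  Tape (behead s) (head None s) r.

Definition push (b : bool) (t : tape M) : tape M :=
  tape_move MoveLeft (tape_write (Some (inl b)) t).

Definition pushes (w : word) (t : tape M) : tape M := foldr push t w.

Lemma pushes_cat u v t : pushes (u ++ v) t = pushes u (pushes v t).
Proof. by rewrite /pushes foldr_cat. Qed.

Lemma tape_right_pushes w t :
  tape_right (pushes w t) = [seq Some (inl b) | b <- w] ++ tape_right t.
Proof. by elim: w => //= b w IH; rewrite IH. Qed.

Lemma leading_bits_cat w s :
  leading_bits ([seq Some (inl b) : option (bool + tm_extra M) | b <- w] ++ s)
  = w ++ leading_bits s.
Proof. by elim: w => //= b w ->. Qed.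

End Reachability.
Arguments reaches {M}.

(** * The three-tape machine and its phases *)

Inductive sum_state :=
  | Start | Copy | CopyBit of bool | Scan | Rewind | Add of bool
  | Den | DenMark | DenOne | DenEnd | Num | NumMark | Increment | Return
  | Halt.

Definition sum_state_code q : nat :=
  match q with
  | Start => 0 | Copy => 1 | CopyBit false => 2 | CopyBit true => 3
  | Scan => 4 | Rewind => 5 | Add false => 6 | Add true => 7
  | Den => 8 | DenMark => 9 | DenOne => 10 | DenEnd => 11
  | Num => 12 | NumMark => 13 | Increment => 14 | Return => 15 | Halt => 16
  end%N.

Definition sum_states : seq sum_state :=
  [:: Start; Copy; CopyBit false; CopyBit true; Scan; Rewind; Add false;
      Add true; Den; DenMark; DenOne; DenEnd; Num; NumMark; Increment; Return;
      Halt].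

Lemma sum_state_codeK : cancel sum_state_code (nth Start sum_states).
Proof. by repeat case. Qed.

HB.instance Definition _ :=
  Countable.copy sum_state (can_type sum_state_codeK).

Lemma sum_states_enum : Finite.axiom sum_states.
Proof. by repeat case. Qed.

HB.instance Definition _ := fintype.isFinite.Build sum_state sum_states_enum.

Local Notation symbol := (option (bool + option bool)).
Local Notation Bit b := (Some (inl b)).
Local Notation Header m := (Some (inr (Some m))).
Local Notation Sentinel := (Some (inr None)).

(** A blank counts as 0, which pads an accumulator shorter than the row. *)
Definition bit_of (x : symbol) : bool := if x is Some (inl b) then b else false.

Definition carry (a b c : bool) : bool := (a && b) || (c && (a || b)).

(* Tape 0 is the input, then the output, pushed leftwards from its last bit;
   tape 1 holds the rows, each followed on its right by a header with its mask
   bit, least significant bit next to the header; tape 2 is the accumulator,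
   least significant bit on the left.  Scanning tape 1 leftwards adds up the
   masked rows; coming back rightwards increments the binary counter formed by
   the mask bits. *)
Definition sum_delta (q : sum_state) (x y z : symbol) :
    option (sum_state * (symbol * tm_move) * (symbol * tm_move) *
            (symbol * tm_move)) :=
  match q, x, y, z with
  | Start, _, _, _ =>
      Some (Copy, (x, Stay), (Sentinel, MoveRight), (Sentinel, MoveRight))
  | Copy, Bit b, _, _ =>
      Some (CopyBit b, (x, MoveRight), (y, Stay), (z, Stay))
  | Copy, _, _, _ => Some (Scan, (x, Stay), (y, MoveLeft), (z, Stay))
  | CopyBit c, _, _, _ =>
      Some (Copy, (x, MoveRight),
            (if c then Bit (bit_of x) else Header false, MoveRight), (z, Stay))
  | Scan, _, Header true, _ =>
      Some (Rewind, (x, Stay), (y, MoveLeft), (z, MoveLeft))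
  | Scan, _, Sentinel, _ =>
      Some (Den, (Bit false, MoveLeft), (y, MoveRight), (z, MoveLeft))
  | Scan, _, _, _ => Some (Scan, (x, Stay), (y, MoveLeft), (z, Stay))
  | Rewind, _, _, Bit _ =>
      Some (Rewind, (x, Stay), (y, Stay), (z, MoveLeft))
  | Rewind, _, _, _ =>
      Some (Add false, (x, Stay), (y, Stay), (z, MoveRight))
  | Add c, _, Bit b, _ =>
      Some (Add (carry b (bit_of z) c), (x, Stay), (y, MoveLeft),
            (Bit (b (+) bit_of z (+) c), MoveRight))
  | Add _, _, _, _ => Some (Scan, (x, Stay), (y, Stay), (z, Stay))
  | Den, _, _, Bit _ =>
      Some (DenMark, (Bit false, MoveLeft), (y, Stay), (z, Stay))
  | Den, _, _, _ =>
      Some (DenOne, (Bit true, MoveLeft), (y, Stay), (z, Stay))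
  | DenMark, _, _, _ =>
      Some (Den, (Bit true, MoveLeft), (y, Stay), (z, MoveLeft))
  | DenOne, _, _, _ =>
      Some (DenEnd, (Bit true, MoveLeft), (y, Stay), (z, Stay))
  | DenEnd, _, _, _ =>
      Some (Num, (Bit false, MoveLeft), (y, Stay), (z, MoveRight))
  | Num, _, _, Bit b =>
      Some (NumMark, (Bit b, MoveLeft), (y, Stay), (z, Stay))
  | Num, _, _, _ =>
      Some (Increment, (Bit false, MoveLeft), (y, Stay), (z, Stay))
  | NumMark, _, _, _ =>
      Some (Num, (Bit true, MoveLeft), (y, Stay), (Sentinel, MoveRight))
  | Increment, _, Header true, _ =>
      Some (Increment, (x, Stay), (Header false, MoveRight), (z, Stay))
  | Increment, _, Header false, _ =>
      Some (Return, (x, Stay), (Header true, MoveRight), (z, Stay))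
  | Increment, _, None, _ =>
      Some (Halt, (x, MoveRight), (y, Stay), (z, Stay))
  | Increment, _, _, _ =>
      Some (Increment, (x, Stay), (y, MoveRight), (z, Stay))
  | Return, _, None, _ => Some (Scan, (x, Stay), (y, MoveLeft), (z, Stay))
  | Return, _, _, _ => Some (Return, (x, Stay), (y, MoveRight), (z, Stay))
  | Halt, _, _, _ => None
  end.

Definition tri {T : Type} (x y z : T) (i : 'I_3) : T :=
  match nat_of_ord i with 0 => x | 1 => y | _ => z end%N.

Definition subset_sum_machine : turing_machine :=
  @TuringMachine sum_state (option bool) 2 Start (fun q h =>
    if sum_delta q (h ord0) (h (inord 1)) (h (inord 2)) is Some (q', a, b, c)
    then Some (q', [ffun i => tri a b c i]) else None).

Local Notation TM := subset_sum_machine.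

Definition conf3 (q : sum_state) (t0 t1 t2 : tape TM) : config TM :=
  @Config TM q [ffun i => tri t0 t1 t2 i].

Lemma step_conf3 q t0 t1 t2 :
  tm_step (conf3 q t0 t1 t2) =
  if sum_delta q (tape_head t0) (tape_head t1) (tape_head t2)
    is Some (q', a, b, c)
  then Some (conf3 q' (@tape_move TM a.2 (@tape_write TM a.1 t0))
                      (@tape_move TM b.2 (@tape_write TM b.1 t1))
                      (@tape_move TM c.2 (@tape_write TM c.1 t2)))
  else None.
Proof.
rewrite /tm_step /= !ffunE /tri /= !inordK //=.
case: (sum_delta _ _ _ _) => [[[[q' a] b] c]|] //; congr Some.
rewrite /conf3; congr Config; apply/ffunP => i; rewrite !ffunE /tri.
by case: (nat_of_ord i) => [|[|k]].
Qed.

Lemma init_conf3 w :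
  tm_init TM w = conf3 Start (input_tape TM w) (blank_tape TM)
    (blank_tape TM).
Proof.
rewrite /tm_init /conf3; congr Config; apply/ffunP => i; rewrite !ffunE /tri.
by rewrite -val_eqE /=; case: (nat_of_ord i) => [|[|k]].
Qed.

Lemma tape_write_head (t : tape TM) : @tape_write TM (tape_head t) t = t.
Proof. by case: t. Qed.

Ltac step :=
  apply: reaches_step;
  first by rewrite step_conf3 /= ?tape_write_head; reflexivity.

(** [None] stands for the header closing a row. The input alphabet has no separator, so each item
    takes two input bits, the first telling a row bit from a header. *)
Definition row_item := option bool.

Definition encode_items (s : seq row_item) : word :=
  flatten
    [seq if c is Some b then [:: true; b] else [:: false; false] | c <- s].

Definition item_symbol (c : row_item) : symbol :=
  if c is Some b then Bit b else Header false.

(** The cells left of the head on tape 0 are left unspecified: the output is pushed over them, and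
    is read only from the head rightwards. *)
Lemma copy_items s l0 l1 t2 :
  exists l0', reaches
    (conf3 Copy (@rt TM l0 [seq Bit b | b <- encode_items s])
       (@rt TM l1 [::]) t2)
    (conf3 Scan (@rt TM l0' [::])
       (@lt TM (rev [seq item_symbol c | c <- s] ++ l1) [:: None]) t2).
Proof.
elim: s l0 l1 => [|c s IH] l0 l1.
  by exists l0; step; exact: reaches_refl.
have [l0' h] := IH (Bit (odflt false c) :: Bit (isSome c) :: l0)
                   (item_symbol c :: l1).
exists l0'; case: c h => [b|] h.
  step; step; rewrite /= rev_cons cat_rcons; exact: h.
step; step; rewrite /= rev_cons cat_rcons; exact: h.
Qed.

(* Words are read here with the least significant bit first; the final carry is
   dropped. *)
Fixpoint add_bits (c : bool) (s acc : word) : word :=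
  if s is b :: s' then
    (b (+) head false acc (+) c) ::
      add_bits (carry b (head false acc) c) s' (behead acc)
  else [::].

Lemma size_add_bits c s acc : size (add_bits c s acc) = size s.
Proof. by elim: s c acc => //= b s IH c acc; rewrite IH. Qed.

(** [x] is the header or sentinel beyond the row. As [acc] is no longer than [s], it is exhausted
    when the row ends, and tape 2 is left with its head just after the new sum. *)
Lemma add_phase s c acc L r J t0 x :
  (size acc <= size s)%N -> (forall b, x <> Bit b) ->
  reaches
    (conf3 (Add c) t0 (@lt TM ([seq Bit b | b <- s] ++ x :: L) r)
       (@rt TM J ([seq Bit b | b <- acc] ++ [:: None])))
    (conf3 Scan t0 (@lt TM (x :: L) (rev [seq Bit b | b <- s] ++ r))
       (@rt TM (rev [seq Bit b | b <- add_bits c s acc] ++ J) [::])).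
Proof.
elim: s c acc r J => [|b s IH] c acc r J hs hx.
  case: acc hs => // _.
  apply: reaches_step; last exact: reaches_refl.
  rewrite step_conf3 /=.
  by case: x hx => [[b /(_ b)|[[]|]]|] //; rewrite tape_write_head.
case: acc hs => [|a acc] hs; step; rewrite /= !rev_cons !cat_rcons.
  exact: (IH _ [::]).
exact: IH.
Qed.

Definition masked_row := (bool * word)%type.

(* The rows as read from the right end of the tape. *)
Definition rows_symbols (rs : seq masked_row) : seq symbol :=
  flatten [seq Header r.1 :: [seq Bit b | b <- r.2] | r <- rs].

Fixpoint sum_rows (rs : seq masked_row) (acc : word) : word :=
  if rs is r :: rs' then
    sum_rows rs' (if r.1 then add_bits false r.2 acc else acc)
  else acc.

Lemma scan_bits s L r t0 t2 :
  reaches (conf3 Scan t0 (@lt TM ([seq Bit b | b <- s] ++ L) r) t2)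
          (conf3 Scan t0 (@lt TM L (rev [seq Bit b | b <- s] ++ r)) t2).
Proof.
elim: s r => [|b s IH] r; first exact: reaches_refl.
by step; rewrite /= rev_cons cat_rcons; exact: IH.
Qed.

Lemma rewind_phase s J r t0 t1 :
  reaches
    (conf3 Rewind t0 t1 (@lt TM ([seq Bit b | b <- s] ++ Sentinel :: J) r))
    (conf3 (Add false) t0 t1
       (@rt TM (Sentinel :: J) (rev [seq Bit b | b <- s] ++ r))).
Proof.
elim: s r => [|b s IH] r; first by step; exact: reaches_refl.
by step; rewrite /= rev_cons cat_rcons; exact: IH.
Qed.

Lemma sum_phase D rs acc r J t0 :
  all (fun r => size r.2 == D) rs -> (size acc <= D)%N ->
  reaches
    (conf3 Scan t0 (@lt TM (rows_symbols rs ++ [:: Sentinel]) r)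
       (@rt TM (rev [seq Bit b | b <- acc] ++ Sentinel :: J) [::]))
    (conf3 Scan t0 (@lt TM [:: Sentinel] (rev (rows_symbols rs) ++ r))
       (@rt TM (rev [seq Bit b | b <- sum_rows rs acc] ++ Sentinel :: J) [::])).
Proof.
elim: rs acc r => [|[m s] rs IH] acc r /=.
  by move=> *; exact: reaches_refl.
move=> /andP[/eqP hs hrs] hacc.
have -> : rows_symbols ((m, s) :: rs) =
  Header m :: [seq Bit b | b <- s] ++ rows_symbols rs by [].
rewrite rev_cons rev_cat cat_rcons -catA -cat1s -!catA /=.
case: m; last first.
  by step; apply: reaches_trans (scan_bits _ _ _ _ _) _; exact: IH.
step; rewrite -map_rev.
apply: reaches_trans (rewind_phase (rev acc) J [:: None] _ _) _.
rewrite map_rev revK.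
have [x [L hL hx]] : exists x : symbol, exists2 L : seq symbol,
    rows_symbols rs ++ [:: Sentinel] = x :: L & (forall b, x <> Bit b).
  by case: (rs) => [|[m' s'] rs'] /=; do 2! eexists.
rewrite hL.
apply: reaches_trans (add_phase _ _ _ _ _ _ _) _ => //; first by rewrite hs.
rewrite -hL; apply: IH => //; first by rewrite size_add_bits hs.
Qed.

(** The denominator 2^|s| is not simplified, so it can be printed by one sweep over the accumulator,
    one 0 per cell. *)
Definition sum_fraction (s : word) : fraction :=
  (false, rev s, true :: nseq (size s) false).

(** Printing goes backwards: the 0 ending the denominator was written on leaving [Scan]; here come
    its zeros, its leading 1, and the 0 that ends the numerator. *)
Lemma den_phase s J r t0 t1 :
  reaches
    (conf3 Den t0 t1 (@lt TM ([seq Bit b | b <- s] ++ Sentinel :: J) r))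
    (conf3 Num
      (pushes (false :: true :: true ::
               flatten [seq [:: true; b] | b <- nseq (size s) false]) t0) t1
       (@rt TM (Sentinel :: J) (rev [seq Bit b | b <- s] ++ r))).
Proof.
elim: s r t0 => [|b s IH] r t0; first by do 3! step; exact: reaches_refl.
step; step; rewrite /= rev_cons cat_rcons.
have := IH (Bit b :: r) (push true (push false t0)).
congr (reaches _ (conf3 _ _ _ _)).
rewrite /pushes /=; do 3! congr push; do 2! rewrite -/(pushes _ _).
by elim: (size s) => //= n ->.
Qed.

(** Each printed cell of the accumulator becomes a sentinel, so the next accumulator starts empty to
    the right of the old one; [J'] collects the used cells. The last bit pushed is the sign. *)
Lemma num_phase s J t0 t1 :
  exists J', reaches
    (conf3 Num t0 t1
      (@rt TM (Sentinel :: J) ([seq Bit b | b <- s] ++ [:: None])))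
    (conf3 Increment
      (pushes (false :: flatten [seq [:: true; b] | b <- rev s]) t0) t1
       (@rt TM (Sentinel :: J') [::])).
Proof.
elim: s J t0 => [|b s IH] J t0; first by exists J; step; exact: reaches_refl.
have [J' h] := IH (Sentinel :: J) (push true (push b t0)).
exists J'; step; step; rewrite rev_cons map_rcons flatten_rcons.
by rewrite -(cat_cons false) pushes_cat; exact: h.
Qed.

Lemma emit_phase s J r t0 :
  exists J', reaches
    (conf3 Scan t0 (@lt TM [:: Sentinel] r)
       (@rt TM (rev [seq Bit b | b <- s] ++ Sentinel :: J) [::]))
    (conf3 Increment (pushes (encode_fraction (sum_fraction s)) t0)
       (@rt TM [:: Sentinel] r) (@rt TM (Sentinel :: J') [::])).
Proof.
have [J' h] := num_phase s J
  (pushes (false :: true :: true ::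
     flatten [seq [:: true; b] | b <- nseq (size s) false]) (push false t0))
  (@rt TM [:: Sentinel] r).
exists J'; step; rewrite -map_rev.
apply: reaches_trans (den_phase _ _ _ _ _) _.
rewrite map_rev revK size_rev.
have -> : encode_fraction (sum_fraction s) =
    (false :: flatten [seq [:: true; b] | b <- rev s]) ++
    (false :: true :: true ::
      flatten [seq [:: true; b] | b <- nseq (size s) false]) ++ [:: false].
  by rewrite /encode_fraction /encode_bits /= -!catA.
by rewrite 2!pushes_cat.
Qed.

(** [None] is the overflow of the counter: all masks have been treated and the machine halts. *)
Fixpoint increment (ps : seq masked_row) : option (seq masked_row) :=
  match ps with
  | [::] => None
  | (false, s) :: ps' => Some ((true, s) :: ps')
  | (true, s) :: ps' => omap (cons (false, s)) (increment ps')
  end.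

Definition left_symbols (ps : seq masked_row) : seq symbol :=
  flatten [seq rcons [seq Bit b | b <- rev r.2] (Header r.1) | r <- ps].

Lemma rev_left_symbols ps : rev (left_symbols ps) = rows_symbols (rev ps).
Proof.
elim: ps => // -[m s] ps IH.
by rewrite rev_cons /rows_symbols map_rcons flatten_rcons -/(rows_symbols _) -IH
  /= /left_symbols /= rev_cat rev_rcons map_rev revK.
Qed.

Lemma return_phase ps l t0 t2 :
  reaches (conf3 Return t0 (@rt TM l (left_symbols ps ++ [:: None])) t2)
          (conf3 Scan t0 (@lt TM (rev (left_symbols ps) ++ l) [:: None]) t2).
Proof.
have : all (fun x : symbol => x != None) (left_symbols ps).
  rewrite /left_symbols; elim: ps => // -[m s] ps IH.
  by rewrite /= all_cat IH all_rcons all_map /= andbT; apply/allP.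
elim: (left_symbols ps) l => [|x S IH] l.
  by move=> _; step; exact: reaches_refl.
case: x => // x /= hS; rewrite rev_cons cat_rcons.
by case: x => [b|[m|]]; step; exact: IH.
Qed.

Lemma increment_bits s l r t0 t2 :
  reaches (conf3 Increment t0 (@rt TM l ([seq Bit b | b <- s] ++ r)) t2)
          (conf3 Increment t0 (@rt TM (rev [seq Bit b | b <- s] ++ l) r) t2).
Proof.
elim: s l => [|b s IH] l; first exact: reaches_refl.
by step; rewrite /= rev_cons cat_rcons; exact: IH.
Qed.

(** On overflow the head of tape 0 steps right, back onto the first bit of the output. *)
Lemma increment_phase ps l t0 t2 : exists t1',
  reaches (conf3 Increment t0 (@rt TM l (left_symbols ps ++ [:: None])) t2)
    (if increment ps is Some ps'
     then conf3 Scan t0 (@lt TM (rev (left_symbols ps') ++ l) [:: None]) t2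
     else conf3 Halt (@tape_move TM MoveRight t0) t1' t2).
Proof.
elim: ps l => [|[m s] ps IH] l.
  by eexists; step; exact: reaches_refl.
have [t1' h] := IH (Header false :: rev [seq Bit b | b <- rev s] ++ l).
exists t1'; rewrite /left_symbols /= -/(left_symbols _) -catA cat_rcons.
apply: reaches_trans (increment_bits _ _ _ _ _) _.
case: m; step.
  move: h; rewrite -/(left_symbols _) /=.
  case: (increment ps) => [ps'|] //=.
  by rewrite rev_cat rev_rcons /= -catA.
apply: reaches_trans (return_phase _ _ _ _) _.
rewrite /= rev_cat rev_rcons /= -catA; exact: reaches_refl.
Qed.

Fixpoint masked_rows (ss : seq word) (v : nat) : seq masked_row :=
  if ss is s :: ss' then (odd v, s) :: masked_rows ss' v./2 else [::].

Lemma increment_masked_rows ss v : (v < 2 ^ size ss)%N ->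
  increment (masked_rows ss v) =
  if (v.+1 < 2 ^ size ss)%N then Some (masked_rows ss v.+1) else None.
Proof.
elim: ss v => [|s ss IH] v /=; first by [].
rewrite expnS mul2n => hv.
have hv2 : (v./2 < 2 ^ size ss)%N by rewrite ltn_half_double.
rewrite -[(v.+1 < _)%N]ltn_half_double /= uphalf_half.
case: (odd v) => /=; last by rewrite !add0n hv2.
by rewrite IH // !add1n; case: ifP.
Qed.

Lemma masked_rows_size ss v D : all (fun s => size s == D) ss ->
  all (fun r : masked_row => size r.2 == D) (masked_rows ss v).
Proof. by elim: ss v => //= s ss IH v /andP[-> h]; exact: IH. Qed.

Definition masked_sum (ss : seq word) (v : nat) : word :=
  sum_rows (rev (masked_rows ss v)) [::].

Definition subset_fractions (ss : seq word) (s : seq nat) : word :=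
  flatten [seq encode_fraction (sum_fraction (masked_sum ss v)) | v <- s].

(** Induction on the number of masks still to be treated. Earlier sums end up further to the right,
    hence the reversed enumeration. *)
Lemma main_loop D ss v J t0 :
  all (fun s => size s == D) ss -> (v < 2 ^ size ss)%N ->
  exists t1' t2', reaches
    (conf3 Scan t0
       (@lt TM (rev (left_symbols (masked_rows ss v)) ++ [:: Sentinel])
                          [:: None])
       (@rt TM (Sentinel :: J) [::]))
    (conf3 Halt (@tape_move TM MoveRight
       (pushes (subset_fractions ss (rev (iota v (2 ^ size ss - v)))) t0))
       t1' t2').
Proof.
move=> hD; move hk : (2 ^ size ss - v)%N => k.
elim: k v J t0 hk => [|k IH] v J t0 hk hv.
  by move: hv; rewrite -subn_gt0 hk.
have [J' h1] := @emit_phase (masked_sum ss v) J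
  (left_symbols (masked_rows ss v) ++ [:: None]) t0.
have [t1' h2] := increment_phase (masked_rows ss v) [:: Sentinel]
  (pushes (encode_fraction (sum_fraction (masked_sum ss v))) t0)
  (@rt TM (Sentinel :: J') [::]).
have h0 := @sum_phase D (rev (masked_rows ss v)) [::] [:: None] J t0.
rewrite all_rev masked_rows_size //= in h0.
move: (h0 isT isT); rewrite -rev_left_symbols revK => {}h0.
have h3 := reaches_trans h0 (reaches_trans h1 h2).
move: h3; rewrite increment_masked_rows //; case: ifP => [hv1|hv1] h3.
  have [|t1'' [t2'' h4]] := IH v.+1 J'
    (pushes (encode_fraction (sum_fraction (masked_sum ss v))) t0) _ hv1.
    by rewrite subnS hk.
  exists t1'', t2''; move: (reaches_trans h3 h4).
  have -> : rev (iota v k.+1) = rcons (rev (iota v.+1 k)) v.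
    by rewrite -rev_cons.
  by rewrite {2}/subset_fractions map_rcons flatten_rcons pushes_cat; apply.
exists t1', (@rt TM (Sentinel :: J') [::]).
have -> : k = 0%N by move: hk hv1; clear; move: (expn _ _) => n; lia.
by rewrite /subset_fractions /rev /= cats0.
Qed.

Definition subset_sum_input (ss : seq word) : word :=
  encode_items (flatten [seq rcons [seq Some b | b <- rev s] None | s <- ss]).

Lemma size_subset_sum_input ss D : all (fun s => size s == D) ss ->
  size (subset_sum_input ss) = (2 * (size ss * D.+1))%N.
Proof.
have hi (l : seq row_item) : size (encode_items l) = (2 * size l)%N.
  by elim: l => //= -[b|] l IH; rewrite /= IH mulnS.
rewrite /subset_sum_input hi => hD; congr muln.
elim: ss hD => //= s ss IH /andP[/eqP hs hD].
by rewrite size_cat IH // size_rcons size_map size_rev hs.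
Qed.

Lemma subset_sum_machine_computes D ss : all (fun s => size s == D) ss ->
  tm_computes TM (subset_sum_input ss)
    (subset_fractions ss (rev (iota 0 (2 ^ size ss)))).
Proof.
move=> hD.
pose items := flatten [seq rcons [seq Some b | b <- rev s] None | s <- ss].
have [l0 h1] := copy_items items [::] [:: Sentinel]
  (@rt TM [:: Sentinel] [::]).
have hit : map item_symbol items = left_symbols (masked_rows ss 0).
  rewrite /items; elim: (ss) => //= s ss' IH.
  by rewrite map_cat map_rcons IH -map_comp.
rewrite hit in h1.
have [|t1 [t2 h2]] := @main_loop D ss 0 [::] (@rt TM l0 [::]) hD.
  by rewrite expn_gt0.
rewrite subn0 in h2.
have h0 : reaches (tm_init TM (subset_sum_input ss))
   (conf3 Copy (@rt TM [::] [seq Bit b | b <- encode_items items])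
      (@rt TM [:: Sentinel] [::]) (@rt TM [:: Sentinel] [::])).
  rewrite init_conf3; step; exact: reaches_refl.
have h := reaches_trans h0 (reaches_trans h1 h2).
have := reaches_computes h; rewrite step_conf3 /= => /(_ erefl).
congr tm_computes; rewrite /conf_output /= ffunE /tri /=.
rewrite tape_right_pushes cats0.
set W := subset_fractions _ _.
have := @leading_bits_cat TM W [::]; rewrite /= !cats0.
by case: W => [|b W].
Qed.

(** * Numerical value of the printed words *)

Lemma nat_of_bits_rcons s b :
  nat_of_bits (rcons s b) = ((nat_of_bits s).*2 + b)%N.
Proof. by rewrite /nat_of_bits foldl_rcons. Qed.

Lemma nat_of_bits_pow2 n : nat_of_bits (true :: nseq n false) = (2 ^ n)%N.
Proof.
elim: n => // n IH.
have -> : true :: nseq n.+1 false = rcons (true :: nseq n false) false.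
  by rewrite rcons_cons; congr cons; elim: n {IH} => //= n {1}->.
by rewrite nat_of_bits_rcons IH addn0 expnS mul2n.
Qed.

Definition lsb_value (s : word) : nat := nat_of_bits (rev s).

Lemma lsb_value_cons b s : lsb_value (b :: s) = (b + 2 * lsb_value s)%N.
Proof. by rewrite /lsb_value rev_cons nat_of_bits_rcons addnC mul2n. Qed.

Lemma lsb_value_lt s : (lsb_value s < 2 ^ size s)%N.
Proof.
elim: s => // b s IH; rewrite lsb_value_cons /= expnS.
move: IH; move: (expn _ _) => n; case: b => /=; lia.
Qed.

Fixpoint lsb_bits (n v : nat) : word :=
  if n is n'.+1 then odd v :: lsb_bits n' v./2 else [::].

Lemma size_lsb_bits n v : size (lsb_bits n v) = n.
Proof. by elim: n v => //= n IH v; rewrite IH. Qed.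

Lemma lsb_bitsK n v : (v < 2 ^ n)%N -> lsb_value (lsb_bits n v) = v.
Proof.
elim: n v => [|n IH] v /=; first by rewrite ltnS leqn0 => /eqP->.
rewrite expnS mul2n => hv.
by rewrite lsb_value_cons IH ?ltn_half_double // mul2n odd_double_half.
Qed.

(** [k] accounts for the dropped final carry; it vanishes as soon as the true sum fits into [size s]
    bits. *)
Lemma add_bits_value c s acc : (size acc <= size s)%N ->
  exists k : nat,
  (lsb_value (add_bits c s acc) + k * 2 ^ size s =
   c + lsb_value s + lsb_value acc)%N.
Proof.
elim: s c acc => [|b s IH] c acc /=.
  by case: acc => // _; exists c; rewrite muln1 !addn0.
move=> hacc; have hb : (size (behead acc) <= size s)%N.
  by rewrite size_behead; lia.
have [k hk] := IH (carry b (head false acc) c) _ hb; exists k.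
have -> : lsb_value acc = (head false acc + 2 * lsb_value (behead acc))%N.
  by case: acc {hacc hb hk} => //= a acc; rewrite lsb_value_cons.
rewrite !lsb_value_cons expnS; move: hk; rewrite /carry.
move: (expn _ _) (lsb_value s) (lsb_value (behead acc)).
move: (lsb_value _) => x n y z.
by case: b; case: (head false acc); case: c => /=; nia.
Qed.

Fixpoint rows_value (rs : seq masked_row) : nat :=
  if rs is r :: rs' then (r.1 * lsb_value r.2 + rows_value rs')%N else 0%N.

Lemma rows_value_rev rs : rows_value (rev rs) = rows_value rs.
Proof.
have hc s t : rows_value (s ++ t) = (rows_value s + rows_value t)%N.
  by elim: s => //= r s ->; rewrite addnA.
elim: rs => // r rs IH; rewrite rev_cons -cats1 hc IH /=; lia.
Qed.

(** The accumulator stays empty until a first row is added and has [D] bits from then on; the bound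
    on the total rules out overflow at every addition. *)
Lemma sum_rows_value D rs acc :
  all (fun r : masked_row => size r.2 == D) rs -> (size acc \in [:: 0; D])%N ->
  (lsb_value acc + rows_value rs < 2 ^ D)%N ->
  (size (sum_rows rs acc) \in [:: 0; D])%N /\
  lsb_value (sum_rows rs acc) = (lsb_value acc + rows_value rs)%N.
Proof.
elim: rs acc => [|[m s] rs IH] acc /=; first by rewrite addn0.
case/andP => /eqP hs hrs hacc.
case: m => /=; last by rewrite mul0n => /IH; apply.
rewrite mul1n => hlt.
have [|k hk] := @add_bits_value false s acc.
  by rewrite hs; move: hacc; rewrite !inE => /orP[] /eqP->.
have hval : lsb_value (add_bits false s acc) = (lsb_value s + lsb_value acc)%N.
  have := lsb_value_lt (add_bits false s acc); move: hk.
  rewrite size_add_bits hs; case: k => [|k] /=; first by lia.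
  move: hlt; rewrite mulSn; move: (expn _ _) (k * _)%N => n1 n2; lia.
have [||h1 h2] := IH (add_bits false s acc) hrs.
- by rewrite size_add_bits hs !inE eqxx orbT.
- by rewrite hval; lia.
by rewrite h1 h2 hval; split=> //; lia.
Qed.

Fixpoint masked_value (xs : seq nat) (v : nat) : nat :=
  if xs is x :: xs' then (odd v * x + masked_value xs' v./2)%N else 0%N.

Lemma rat_of_sum_fraction s :
  rat_of_fraction (sum_fraction s) = (lsb_value s)%:R / 2 ^+ size s.
Proof.
by rewrite /rat_of_fraction /= nat_of_bits_pow2 expr0 mul1r natrX.
Qed.

Lemma masked_value_le xs v : (masked_value xs v <= sumn xs)%N.
Proof.
elim: xs v => //= x xs IH v; apply: leq_add => //.
by case: (odd v); rewrite ?mul1n.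
Qed.

Theorem subset_sums_computable D (xs : seq nat) : (sumn xs < 2 ^ D)%N ->
  exists w v,
    [/\ size w = (2 * (size xs * D.+1))%N,
        tm_computes subset_sum_machine w v &
        exists s : seq fraction,
        [/\ v = flatten [seq encode_fraction x | x <- s], all fraction_ok s &
        [seq rat_of_fraction x | x <- s] =
        [seq (masked_value xs k)%:R / 2 ^+ D |
           k <- rev (iota 0 (2 ^ size xs))]]].
Proof.
move=> hxs.
pose ss := [seq lsb_bits D x | x <- xs].
have hss : all (fun s : word => size s == D) ss.
  by rewrite all_map; apply/allP => x _ /=; rewrite size_lsb_bits.
have hsz : size ss = size xs by rewrite size_map.
exists (subset_sum_input ss).
exists (subset_fractions ss (rev (iota 0 (2 ^ size ss)))).
split; first by rewrite (size_subset_sum_input hss) hsz.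
  exact: subset_sum_machine_computes hss.
exists [seq sum_fraction (masked_sum ss v) | v <- rev (iota 0 (2 ^ size ss))].
split; first by rewrite /subset_fractions -map_comp.
  by rewrite all_map; apply/allP => v _ /=;
    rewrite /fraction_ok /= nat_of_bits_pow2 expn_gt0.
rewrite -map_comp hsz; apply: eq_map => v /=.
rewrite rat_of_sum_fraction.
have hrv : rows_value (masked_rows ss v) = masked_value xs v.
  rewrite /ss; move: hxs; clear; elim: xs v => //= x xs IH v hxs.
  by rewrite lsb_bitsK ?IH //; lia.
have [|||h1 h2] := @sum_rows_value D (rev (masked_rows ss v)) [::].
- by rewrite all_rev masked_rows_size.
- by [].
- by rewrite rows_value_rev hrv (leq_ltn_trans _ hxs) // masked_value_le.
rewrite -/(masked_sum ss v) in h1 h2.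
rewrite h2 rows_value_rev hrv; move: h1.
rewrite !inE => /orP[/nilP h1|/eqP->//].
(* With an empty accumulator the machine prints 0/1 instead of 0/2^D, which has the same value. *)
move: h2; rewrite h1 rows_value_rev hrv add0n => <-.
by rewrite !mul0r.
Qed.

Lemma masked_value_bits (xs : seq nat) v :
  masked_value xs v = (\sum_(i < size xs) odd (iter i half v) * nth 0 xs i)%N.
Proof.
elim: xs v => [|x xs IH] v /=; first by rewrite big_ord0.
rewrite big_ord_recl /= IH; congr addn; apply: eq_bigr => i _.
by rewrite -iterSr.
Qed.

Lemma mask_index n (b : nat -> bool) :
  exists2 v, (v < 2 ^ n)%N & forall i, (i < n)%N -> odd (iter i half v) = b i.
Proof.
elim: n b => [|n IH] b; first by exists 0%N.
have [v hv hb] := IH (b \o succn); exists (b 0 + v.*2)%N.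
  by rewrite expnS mul2n; move: hv; move: (expn _ _) => k; case: (b 0%N); lia.
case=> [|i] hi /=; first by rewrite oddD odd_double addbF; case: (b 0%N).
by rewrite -iterS iterSr half_bit_double hb.
Qed.

(** * Geometry of central Cantor sets *)

Section Hausdorff.
Variable R : realType.
Implicit Types (A B : set R) (r e : R).

Lemma edist_inf_lt A x e : (edist_inf A x < e%:E)%E ->
  exists2 y, A y & `|x - y| < e.
Proof.
rewrite /edist_inf => /ereal_inf_lt[_ [y Ay <-]].
move=> /ereal_inf_lt[_ [r [r0 hr] <-]].
rewrite lte_fin => re; exists y => //.
by move: hr; rewrite /ball /=; move/lt_trans; apply.
Qed.

Lemma hausdorff_dist_lt A B e : (hausdorff_dist A B < e%:E)%E ->
  (forall x, B x -> exists2 y, A y & `|x - y| < e) /\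
  (forall x, A x -> exists2 y, B y & `|x - y| < e).
Proof.
rewrite /hausdorff_dist gt_max => /andP[h1 h2].
split=> x Bx; apply: edist_inf_lt.
  by apply: le_lt_trans h1; apply: ereal_sup_ubound; exists x.
by apply: le_lt_trans h2; apply: ereal_sup_ubound; exists x.
Qed.

Lemma edist_inf_le A x y r : A y -> `|x - y| < r -> (edist_inf A x <= r%:E)%E.
Proof.
move=> Ay xyr; apply: ge_ereal_inf; exists (edist (x, y)); first by exists y.
by apply: edist_fin => //; apply: le_lt_trans xyr; exact: normr_ge0.
Qed.

Lemma hausdorff_dist_le A B r :
  (forall x, B x -> exists2 y, A y & `|x - y| < r) ->
  (forall x, A x -> exists2 y, B y & `|x - y| < r) ->
  (hausdorff_dist A B <= r%:E)%E.
Proof.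
move=> h1 h2; rewrite /hausdorff_dist ge_max; apply/andP; split;
  apply: ge_ereal_sup => _ [x Bx <-].
  by have [y Ay hy] := h1 _ Bx; exact: edist_inf_le hy.
by have [y Ay hy] := h2 _ Bx; exact: edist_inf_le hy.
Qed.

End Hausdorff.

Section Cantor.
Variable R : realType.
Implicit Types (lam : nat -> R) (b : nat -> bool).

Fixpoint level_length lam (k : nat) : R :=
  if k is k'.+1 then level_length lam k' * (lam k' / 2) else 1.

Definition level_shift lam k : R := level_length lam k - level_length lam k.+1.

Definition left_endpoint lam b k : R :=
  \sum_(i < k) (b i)%:R * level_shift lam i.

Lemma left_endpointS lam b k : left_endpoint lam b k.+1 =
  left_endpoint lam b k + (b k)%:R * level_shift lam k.
Proof. by rewrite /left_endpoint big_ord_recr. Qed.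

Lemma eq_left_endpoint lam b b' k : (forall i, (i < k)%N -> b i = b' i) ->
  left_endpoint lam b k = left_endpoint lam b' k.
Proof. by move=> h; apply: eq_bigr => i _; rewrite h. Qed.

Lemma cantor_intervalsP lam k (J : R * R) :
  reflect (exists b, J = (left_endpoint lam b k,
                          left_endpoint lam b k + level_length lam k))
          (J \in cantor_intervals lam k).
Proof.
elim: k J => [|k IH] J.
  rewrite /= inE; apply: (iffP eqP) => [->|[b ->]].
    by exists xpredT; rewrite /left_endpoint big_ord0 add0r.
  by rewrite /left_endpoint big_ord0 add0r.
have split_J b : remove_middle (lam k) (left_endpoint lam b k,
      left_endpoint lam b k + level_length lam k) =
    [:: (left_endpoint lam b k, left_endpoint lam b k + level_length lam k.+1);
        (left_endpoint lam b k + level_shift lam k,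
         left_endpoint lam b k + level_shift lam k + level_length lam k.+1)].
  rewrite /remove_middle /level_shift /=.
  by congr [:: (_, _); (_, _)]; field.
apply: (iffP flatten_mapP) => [[I /IH[b ->]]|[b ->]].
  rewrite split_J !inE => /orP[] /eqP ->.
    (* The digits below [k] are kept; digit [k] is set to 0 for the left half and to 1 for the right
       half. *)
    exists (fun i => (i < k)%N && b i); rewrite left_endpointS ltnn mul0r addr0.
    by rewrite -(@eq_left_endpoint _ b) // => i ->.
  exists (fun i => (i == k) || b i); rewrite left_endpointS eqxx mul1r.
  by rewrite -(@eq_left_endpoint _ b) // => i ik; rewrite ltn_eqF.
exists (left_endpoint lam b k, left_endpoint lam b k + level_length lam k).
  by apply/IH; exists b.
rewrite split_J left_endpointS !inE; case: (b k); rewrite ?mul1r ?mul0r ?addr0.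
  by rewrite eqxx orbT.
by rewrite eqxx.
Qed.

Lemma cantor_levelP lam k x : cantor_level lam k x <->
  exists b,
    left_endpoint lam b k <= x <= left_endpoint lam b k + level_length lam k.
Proof.
split=> [[J /cantor_intervalsP[b ->]]|[b hb]].
  by rewrite /= in_itv /= => hx; exists b.
exists (left_endpoint lam b k, left_endpoint lam b k + level_length lam k) => /=.
  by apply/cantor_intervalsP; exists b.
by rewrite in_itv.
Qed.

Variables (lam : nat -> R) (lam01 : forall k, 0 < lam k < 1).

Lemma level_length_gt0 k : 0 < level_length lam k.
Proof.
elim: k => //= k IH; have /andP[l0 _] := lam01 k.
by rewrite mulr_gt0 // divr_gt0.
Qed.

Lemma level_lengthS_lt k : level_length lam k.+1 < level_length lam k / 2.
Proof.
have /andP[l0 l1] := lam01 k; have := level_length_gt0 k.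
by rewrite /= mulrA ltr_pM2r ?invr_gt0 // => h; rewrite gtr_pMr.
Qed.

Lemma level_shift_gt0 k : 0 < level_shift lam k.
Proof.
by have := level_lengthS_lt k; have := level_length_gt0 k;
  rewrite /level_shift; lra.
Qed.

Lemma level_length_le k : level_length lam k <= 2^-1 ^+ k.
Proof.
elim: k => // k IH; apply: le_trans (ltW (level_lengthS_lt k)) _.
by rewrite exprSr ler_pM2r ?invr_gt0.
Qed.

(** Nestedness of the intervals along one digit sequence: a step moves the left endpoint by 0 or by
    l_k - l_(k+1), hence never out of the parent interval. *)
Lemma left_endpoint_between b k m : (k <= m)%N ->
  left_endpoint lam b k <= left_endpoint lam b m <=
  left_endpoint lam b k + level_length lam k - level_length lam m.
Proof.
move=> /subnK <-; elim: (m - k)%N => [|j IH]; first by rewrite add0n addrK lexx.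
rewrite addSn left_endpointS; have := level_shift_gt0 (j + k).
move: IH; rewrite /level_shift; move=> /andP[h1 h2] h3.
by case: (b _); rewrite ?mul1r ?mul0r; apply/andP; split; lra.
Qed.

Lemma left_endpoint_cantor b k : central_cantor lam (left_endpoint lam b k).
Proof.
move=> j _; apply/cantor_levelP.
pose b' i := b i && (i < k)%N.
have hb m : (k <= m)%N -> left_endpoint lam b' m = left_endpoint lam b k.
  move=> /subnK <-; elim: (m - k)%N => [|i IH].
    by rewrite add0n; apply: eq_left_endpoint => i ik; rewrite /b' ik andbT.
  by rewrite addSn left_endpointS IH /b' ltnNge leq_addl andbF mul0r addr0.
exists b'; rewrite -(hb (maxn k j)) ?leq_maxl //.
have := @left_endpoint_between b' j (maxn k j) (leq_maxr _ _).
have := level_length_gt0 (maxn k j); lra.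
Qed.

(** l_k is the right end of the leftmost interval of level k. At a deeper level j it stays a right
    end, for the digits equal to 1 from k on: their shifts telescope to l_k - l_j. *)
Lemma level_length_cantor k : central_cantor lam (level_length lam k).
Proof.
move=> j _; apply/cantor_levelP; case: (leqP j k) => jk.
  exists xpred0; rewrite /left_endpoint big1 ?add0r => [|i _]; last first.
    by rewrite mul0r.
  rewrite ltW ?level_length_gt0 //=.
  move: jk => /subnK <-; elim: (k - j)%N => [|i IH]; first by rewrite add0n.
  by rewrite addSn; have := level_lengthS_lt (i + j);
    have := level_length_gt0 (i + j); move: IH; lra.
exists (fun i => (k <= i)%N).
suff -> : left_endpoint lam (fun i => (k <= i)%N) j =
    level_length lam k - level_length lam j.
  by have := level_length_gt0 j; lra.
move: jk => /ltnW /subnK <-; elim: (j - k)%N => [|i IH].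
  rewrite add0n subrr /left_endpoint big1 // => i _.
  by rewrite leqNgt ltn_ord mul0r.
rewrite addSn left_endpointS IH leq_addl mul1r /level_shift; lra.
Qed.

(** The shifts decrease, so a digit 1 at any position i <= k already pushes x beyond the shift of
    index k; if there is none, x lies in the leftmost interval. *)
Lemma cantor_gap k x : central_cantor lam x ->
  x <= level_length lam k.+1 \/ level_shift lam k <= x.
Proof.
move=> /(_ k.+1 I) /cantor_levelP[b hb].
have h0 i : 0 <= (b i)%:R * level_shift lam i.
  by rewrite mulr_ge0 // ltW // level_shift_gt0.
have [[i [ik bi]]|hn] := pselect (exists i, (i <= k)%N /\ b i).
  right; have : level_shift lam i <= left_endpoint lam b k.+1.
    rewrite /left_endpoint (bigD1 (Ordinal (ik : (i < k.+1)%N))) //=.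
    rewrite bi mul1r lerDl.
    exact: sumr_ge0.
  suff : level_shift lam k <= level_shift lam i by move: hb; lra.
  move: ik => /subnK <-; elim: (k - i)%N => [|j IH]; first by rewrite add0n.
  apply: le_trans IH; rewrite addSn /level_shift.
  have := level_lengthS_lt (j + i).+1; have := level_lengthS_lt (j + i).
  have := level_length_gt0 (j + i).+2; lra.
left; suff h : left_endpoint lam b k.+1 = 0 by move: hb; rewrite h; lra.
apply: big1 => i _; case bi : (b i); last by rewrite mul0r.
by case: hn; exists i; split=> //; rewrite -ltnS.
Qed.

End Cantor.

(** * Upper bound *)

Section UpperBound.
Variable R : realType.
Variables (lam : nat -> R) (lam01 : forall k, 0 < lam k < 1).

Lemma sum_level_shift k :
  \sum_(i < k) level_shift lam i = 1 - level_length lam k.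
Proof.
elim: k => [|k IH]; first by rewrite big_ord0 subrr.
by rewrite big_ord_recr /= IH /level_shift /=; ring.
Qed.

(* Precision 2^(-2N) suffices, since the N truncation errors add up to at most
   N * 2^(-2N) <= 2^(-N). *)
Let digits N : seq nat :=
  mkseq (fun i => Num.truncn (2 ^+ (2 * N) * level_shift lam i)) N.

Let truncn_shift N i : let y := 2 ^+ (2 * N) * level_shift lam i in
  (Num.truncn y)%:R <= y < (Num.truncn y).+1%:R.
Proof.
apply: truncn_itv; rewrite mulr_ge0 ?exprn_ge0 //.
exact/ltW/level_shift_gt0.
Qed.

(** The shifts telescope to 1 - l_N < 1, so no subset sum overflows 2N bits. *)
Let sumn_digits N : (sumn (digits N) < 2 ^ (2 * N))%N.
Proof.
rewrite -(ltr_nat R) natrX sumnE big_map.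
rewrite -[N in iota 0 N]subn0 -/(index_iota 0 N) big_mkord natr_sum.
have : \sum_(i < N) 2 ^+ (2 * N) * level_shift lam i < 2 ^+ (2 * N) :> R.
  rewrite -mulr_sumr sum_level_shift gtr_pMr ?exprn_gt0 //.
  by have := level_length_gt0 lam01 N; lra.
apply: le_lt_trans; apply: ler_sum => i _.
by have /andP[] := truncn_shift N i.
Qed.

Let masked_digits N v :
  `|left_endpoint lam (fun i => odd (iter i half v)) N -
    (masked_value (digits N) v)%:R / 2 ^+ (2 * N)| <= 2^-1 ^+ N.
Proof.
have p0 : 0 < 2 ^+ (2 * N) :> R by rewrite exprn_gt0.
rewrite masked_value_bits size_mkseq.
rewrite -(ler_pM2r p0) -[X in _ * X <= _](gtr0_norm p0) -normrM mulrBl.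
rewrite divfK ?gt_eqF //.
have -> : 2^-1 ^+ N * 2 ^+ (2 * N) = 2 ^+ N :> R.
  by rewrite mul2n -addnn exprD mulrA -exprMn mulVf ?expr1n ?mul1r ?pnatr_eq0.
apply: (@le_trans _ _ N%:R); last first.
  by rewrite -natrX ler_nat ltnW // ltn_expl.
rewrite natr_sum /left_endpoint mulr_suml -sumrB.
apply: le_trans (ler_norm_sum _ _ _) _.
have -> : N%:R = \sum_(i < N) 1 :> R by rewrite sumr_const card_ord.
apply: ler_sum => i _; rewrite nth_mkseq // natrM.
rewrite -mulrA -mulrBr [level_shift _ _ * _]mulrC.
have /andP[h1 h2] := truncn_shift N i.
case: (odd _); rewrite ?mul0r ?normr0 ?ler01 // mul1r.
by rewrite ger0_norm ?subr_ge0 //; rewrite -natr1 in h2; lra.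
Qed.

(** One 2^(-N) comes from l_N, one from truncation; the third makes the pointwise inequalities
    strict, as [hausdorff_dist_le] asks. *)
Lemma cantor_approximation N : exists w v F,
  [/\ size w = (2 * (N * (2 * N).+1))%N,
      tm_computes subset_sum_machine w v,
      exists s : seq fraction,
        [/\ v = flatten [seq encode_fraction x | x <- s], all fraction_ok s &
            F = [seq rat_of_fraction x | x <- s]] &
      (hausdorff_dist (@points R F) (central_cantor lam) <=
        (3 * 2^-1 ^+ N)%:E)%E].
Proof.
have [w [v [hw hv [s [hs1 hs2 hs3]]]]] :=
  subset_sums_computable (sumn_digits N).
exists w, v, [seq rat_of_fraction x | x <- s].
rewrite size_mkseq in hw hs3; split=> //; first by exists s.
have q0 : 0 < 2^-1 ^+ N :> R by rewrite exprn_gt0 ?invr_gt0.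
have ratr_digits k : ratr ((masked_value (digits N) k)%:R / 2 ^+ (2 * N)) =
    (masked_value (digits N) k)%:R / 2 ^+ (2 * N) :> R.
  by rewrite fmorph_div rmorphXn /= !ratr_nat.
apply: hausdorff_dist_le => [x Cx|_ [q /= hq <-]].
  have /cantor_levelP[b hb] := Cx N I.
  have [k hk hkb] := mask_index N b.
  exists (ratr ((masked_value (digits N) k)%:R / 2 ^+ (2 * N))).
    exists ((masked_value (digits N) k)%:R / 2 ^+ (2 * N)) => //=.
    by rewrite hs3; apply/mapP; exists k; rewrite // mem_rev mem_iota.
  have := masked_digits N k; rewrite (eq_left_endpoint lam hkb) ratr_digits.
  have := level_length_le lam01 N; move: hb => /andP[h1 h2].
  rewrite ler_norml ltr_norml => h3 /andP[h4 h5].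
  by apply/andP; split; lra.
move: hq; rewrite hs3 => /mapP[k _ ->].
exists (left_endpoint lam (fun i => odd (iter i half k)) N).
  exact: left_endpoint_cantor.
rewrite ratr_digits distrC; apply: le_lt_trans (masked_digits N k) _.
by rewrite ltr_pMl // ltr1n.
Qed.

End UpperBound.

Lemma Delta_le (R : realType) U (K : set R) eps p F :
  produces U p F -> (hausdorff_dist (@points R F) K < eps%:E)%E ->
  (Delta U K eps <= (size p)%:R%:E)%E.
Proof.
by move=> hp hF; apply: ereal_inf_lbound; exists p => //; exists F.
Qed.

Theorem Delta_cantor_upper_bound (R : realType) (U : turing_machine)
    (U_univ : universal U) (lam : nat -> R) :
  (forall k, 0 < lam k < 1) ->
  preccurlyeq (Delta U (central_cantor lam)) (fun eps => (ln (eps^-1) ^+ 2)%:E).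
Proof.
move=> lam01; have [code hcode] := U_univ subset_sum_machine.
have ln2 : 0 < ln 2 :> R by rewrite ln_gt0 // ltr1n.
pose K := (ln 2)^-1 : R; have K0 : 0 < K by rewrite invr_gt0.
(* The input has 2N(2N+1) <= 6N^2 bits, with N <= (K + 3) log(1/eps) once the logarithm is at least
   1. *)
exists ((size code)%:R + 6 * (K + 3) ^+ 2).
  by rewrite ltr_wpDl // mulr_gt0 // exprn_gt0 // addr_gt0.
near=> eps.
have e0 : 0 < eps by near: eps; exact: nbhs_right_gt.
have e1 : eps < expR (-1) by near: eps; apply: nbhs_right_lt; exact: expR_gt0.
set X := ln eps^-1.
have X1 : 1 <= X.
  rewrite /X lnV ?posrE // lerNr -[X in _ <= X]expRK.
  by rewrite ler_ln ?posrE ?expR_gt0 // ltW.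
(* Truncation plus 1 gives 2^(-N) < eps; two further halvings absorb the factor 3. *)
pose N := (Num.truncn (K * X) + 3)%N.
have /andP[t1 t2] := @truncn_itv R (K * X) (ltac:(nra)).
have hNX : N%:R <= (K + 3) * X.
  by rewrite natrD mulrDl; apply: lerD => //; rewrite ler_peMr.
have hN : 3 * 2^-1 ^+ N < eps.
  have : 2^-1 ^+ (Num.truncn (K * X)).+1 < eps.
    rewrite -[2^-1]lnK ?posrE ?invr_gt0 // -expRM_natl.
    rewrite -[X in _ < X]lnK ?posrE // ltr_expR lnV ?posrE //.
    have -> : ln eps = - X by rewrite /X lnV ?posrE // opprK.
    by rewrite mulrN ltrN2 -ltr_pdivrMr // mulrC.
  rewrite /N addn3; move: (Num.truncn _).+1 => k.
  by rewrite 2!exprSr; move: (_ ^+ k) e0 => a; clear; lra.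
have N1 : (0 < N)%N by rewrite /N addn3.
clearbody N.
have [w [v [F [hw hv [s [hs1 hs2 hs3]] hF]]]] := cantor_approximation lam01 N.
have hp : produces U (code ++ w) F.
  by exists s; split=> //; apply/hcode; rewrite -hs1.
apply: le_trans (Delta_le hp (le_lt_trans hF _)) _; first by rewrite lte_fin.
rewrite -EFinM lee_fin size_cat hw natrD mulrDl.
apply: lerD; first by rewrite ler_peMr // exprn_ege1.
apply: (@le_trans _ _ (6 * (N%:R ^+ 2))).
  by rewrite -natrX -natrM ler_nat; move: N1; clear; nia.
rewrite -mulrA -exprMn ler_pM2l //; apply: lerXn2r; rewrite ?nnegrE //.
exact: le_trans (ler0n _ _) hNX.
Unshelve. all: by end_near.
Qed.

(** * Lower bound *)

Lemma encode_bits_inj s s' u u' :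
  encode_bits s ++ u = encode_bits s' ++ u' -> s = s' /\ u = u'.
Proof.
rewrite /encode_bits; elim: s s' => [|b s IH] [|b' s'] //=.
  by case.
by case=> -> /IH[-> ->].
Qed.

Lemma encode_fractions_inj (s s' : seq fraction) :
  flatten [seq encode_fraction x | x <- s] =
  flatten [seq encode_fraction x | x <- s'] -> s = s'.
Proof.
have encode_cat x u : encode_fraction x ++ u =
    x.1.1 :: encode_bits x.1.2 ++ (encode_bits x.2 ++ u).
  by rewrite /encode_fraction cat_cons -catA.
elim: s s' => [|[[a n] d] s IH] [|[[a' n'] d'] s'] //.
have flatE (x : fraction) l : flatten [seq encode_fraction y | y <- x :: l] =
  encode_fraction x ++ flatten [seq encode_fraction y | y <- l] by [].
rewrite !flatE !encode_cat => -[-> /encode_bits_inj[/= ->]].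
move=> /encode_bits_inj[-> /IH ->].
by [].
Qed.

(** The machine is deterministic and the output code self-delimiting. Hence one program accounts for
    one box in the union bound. *)
Lemma produces_inj U p F F' : produces U p F -> produces U p F' -> F = F'.
Proof.
move=> [s [h _ ->]] [s' [h' _ ->]].
by have /encode_fractions_inj -> := tm_computes_inj h h'.
Qed.

(** * Rigidity: Hausdorff-close sets have close ratios *)

Section Rigidity.
Variables (R : realType) (lam mu : nat -> R) (e eta : R) (n : nat).
Hypotheses (lam01 : forall k, 0 < lam k < 1) (mu01 : forall k, 0 < mu k < 1).

(* If l_(k+1) exceeded m_(k+1) by e, then the point of the second set close to
   l_(k+1) would lie beyond the gap (m_(k+1), m_k - m_(k+1)), which is
   impossible because l_(k+1) < m_k / 2 by a margin eta. *)
Lemma level_length_step (l m : nat -> R) k :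
  (forall k, 0 < l k < 1) -> (forall k, 0 < m k < 1) -> 0 < e -> 0 < eta ->
  l k <= 1 - eta -> m k <= 1 - eta ->
  3 * e <= eta * (level_length l k + level_length m k) ->
  (forall x, central_cantor l x ->
     exists2 y, central_cantor m y & `|x - y| < e) ->
  `|level_length l k - level_length m k| < e ->
  level_length l k.+1 - level_length m k.+1 < e.
Proof.
move=> l01 m01 e0 eta0 lk mk small close; rewrite ltr_norml => /andP[h1 h2].
rewrite ltNge; apply/negP => far.
have [y Cy] := close _ (level_length_cantor l01 k.+1).
rewrite ltr_norml => /andP[h3 h4].
have [hy|hy] := cantor_gap m01 k Cy; first by lra.
have l0 := level_length_gt0 l01 k; have m0 := level_length_gt0 m01 k.
move: hy h3 h4; rewrite /level_shift /= => hy h3 h4.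
have hl : level_length l k * (l k / 2) <= level_length l k * ((1 - eta) / 2).
  by rewrite ler_pM2l // ler_pM2r // invr_gt0.
have hm : level_length m k * (m k / 2) <= level_length m k * ((1 - eta) / 2).
  by rewrite ler_pM2l // ler_pM2r // invr_gt0.
(* With l, m the lengths of level k: m - e < l_(k+1) + m_(k+1) <= (1 - eta)(l + m)/2, while m > (l +
   m)/2 - e/2. Hence eta (l + m) < 3e, which is where the 3 comes from. *)
lra.
Qed.

Hypotheses (e0 : 0 < e) (eta0 : 0 < eta)
  (lam_eta : forall k, (k < n)%N -> lam k <= 1 - eta)
  (mu_eta : forall k, (k < n)%N -> mu k <= 1 - eta)
  (small : 3 * e <= eta * level_length lam n)
  (lam_mu : forall x, central_cantor lam x ->
     exists2 y, central_cantor mu y & `|x - y| < e)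
  (mu_lam : forall x, central_cantor mu x ->
     exists2 y, central_cantor lam y & `|x - y| < e).

Let level_length_ge k : (k <= n)%N -> level_length lam n <= level_length lam k.
Proof.
move=> /subnK <-; elim: (n - k)%N => // j IH.
rewrite addSn; have := level_lengthS_lt lam01 (j + k).
by have := level_length_gt0 lam01 (j + k); move: IH; lra.
Qed.

(** The error does not accumulate: level k only serves to locate the gap, and the bound [e] at level
    k+1 comes afresh from the Hausdorff distance. *)
Lemma level_length_close k : (k <= n)%N ->
  `|level_length lam k - level_length mu k| < e.
Proof.
elim: k => [|k IH] kn; first by rewrite subrr normr0.
have {}IH := IH (ltnW kn).
have small_k : 3 * e <= eta * (level_length lam k + level_length mu k).
  apply: le_trans small _; rewrite ler_pM2l //.
  have := level_length_ge (ltnW kn); have := level_length_gt0 mu01 k; lra.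
have h1 := level_length_step lam01 mu01 e0 eta0 (lam_eta kn) (mu_eta kn)
  small_k lam_mu IH.
have h2 : level_length mu k.+1 - level_length lam k.+1 < e.
  apply: (level_length_step mu01 lam01 e0 eta0 (mu_eta kn) (lam_eta kn)) => //.
    by rewrite addrC.
  by rewrite distrC.
by rewrite ltr_norml; apply/andP; split; move: h1 h2; lra.
Qed.

(** Since 2 l_(k+1) = l_k lam_k, the difference of the ratios times l_k is 2(l_(k+1) - m_(k+1)) -
    mu_k (l_k - m_k), at most 2e + e. *)
Lemma ratio_close k : (k < n)%N ->
  `|lam k - mu k| < 3 * e / level_length lam n.
Proof.
move=> kn; have := level_length_close kn; have := level_length_close (ltnW kn).
have ln0 := level_length_gt0 lam01 n; have lk0 := level_length_gt0 lam01 k.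
have mk0 := level_length_gt0 mu01 k.
have lnk := level_length_ge (ltnW kn); have /andP[m0 m1] := mu01 k.
rewrite ltr_pdivlMr // => h1 h2.
apply: (@le_lt_trans _ _ (`|lam k - mu k| * level_length lam k)).
  by rewrite ler_wpM2l.
rewrite -{1}(gtr0_norm lk0) -normrM.
have -> : (lam k - mu k) * level_length lam k =
   2 * (level_length lam k.+1 - level_length mu k.+1) -
   mu k * (level_length lam k - level_length mu k) by rewrite /=; field.
apply: le_lt_trans (ler_normB _ _) _.
rewrite !normrM (gtr0_norm m0) gtr0_norm //.
have : mu k * `|level_length lam k - level_length mu k| <=
  `|level_length lam k - level_length mu k| by rewrite ler_piMl // ltW.
move: h1 h2; lra.
Qed.

End Rigidity.

Lemma level_length_ge_expr (R : realType) (lam : nat -> R) (c : R) n :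
  0 <= c -> (forall k, (k < n)%N -> c <= lam k) ->
  (c / 2) ^+ n <= level_length lam n.
Proof.
move=> c0; elim: n => // n IH h; rewrite exprSr /=.
apply: ler_pM; rewrite ?exprn_ge0 ?divr_ge0 //.
  by apply: IH => k kn; apply: h; exact: ltnW.
by rewrite ler_pM2r ?invr_gt0 // h.
Qed.

(** * Probabilities of boxes and of extreme ratios *)

Section Probability.
Context d (Omega : measurableType d) (R : realType) (P : probability Omega R).
Variables (lam : nat -> {RV P >-> R}) (f : R -> R) (M : R).
Hypotheses (indep : mutually_independent lam)
  (dens : forall k, has_density01 (lam k) f)
  (mf : measurable_fun (`]0, 1[%classic : set R) f)
  (f0 : forall x, 0 < x < 1 -> 0 <= f x) (fM : forall x, 0 < x < 1 -> f x <= M).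

Let M0 : 0 <= M.
Proof.
pose x : R := 2^-1; have h : 0 < x < 1 by apply/andP; split; rewrite /x; lra.
exact: le_trans (f0 h) (fM h).
Qed.

Lemma measurable_preimage_itv k (a b : R) :
  measurable (lam k @^-1` `[a, b]).
Proof. by rewrite -[X in measurable X]setTI; exact: measurable_funPT. Qed.

Lemma prob_itv_le k (a b : R) : a <= b ->
  (P (lam k @^-1` `[a, b]) <= (M * (b - a))%:E)%E.
Proof.
move=> ab; have [_ /(_ `[a, b]%classic (measurable_itv _))] := dens k.
rewrite /distribution /pushforward => ->.
have mD : measurable (`[a, b] `&` `]0, 1[ : set R).
  by apply: measurableI; exact: measurable_itv.
apply: (@le_trans _ _ (\int[lebesgue_measure]_(x in `[a, b] `&` `]0%R, 1%R[)
    (cst M%:E x))%E).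
  apply: ge0_le_integral => //.
  - by move=> x [_]; rewrite /= in_itv /= lee_fin => /f0.
  - apply/measurable_realfun.measurable_EFinP.
    by apply: measurable_funS mf => //; exact: subIsetr.
  - by move=> x [_]; rewrite /= in_itv /= lee_fin => /fM.
rewrite integral_cst // EFinM; apply: lee_pmul; rewrite ?lee_fin //.
apply: (@le_trans _ _ (lebesgue_measure (`[a, b]%classic : set R))).
  by apply: le_measure; rewrite ?inE //.
rewrite lebesgue_measure_itv /= lte_fin; case: ifP => // _.
by rewrite lee_fin subr_ge0.
Qed.

Lemma prob_box_le n (c : nat -> R) rho : 0 <= rho ->
  let E :=
    \bigcap_(k in [set` iota 0 n]) (lam k @^-1` `[c k - rho, c k + rho]) in
  measurable E /\ (P E <= ((2 * M * rho) ^+ n)%:E)%E.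
Proof.
move=> r0 E; split.
  by apply: fin_bigcap_measurable => [|k _];
    [exact: finite_seq|exact: measurable_preimage_itv].
pose A k := `[c k - rho, c k + rho]%classic.
rewrite /E (indep (iota_uniq 0 n) (A := A));
  last by move=> k; exact: measurable_itv.
elim: n {E} => [|n IH]; first by rewrite big_nil expr0.
rewrite -addn1 iotaD add0n big_cat /= big_seq1 addn1 exprSr EFinM.
apply: lee_pmul => //; first by apply: prode_ge0 => i _; exact: measure_ge0.
apply: le_trans (prob_itv_le _ _) _; first by lra.
by rewrite lee_fin; lra.
Qed.

Lemma prob_atypical_le n (eta : R) : 0 <= eta -> exists B : set Omega,
  [/\ measurable B, (P B <= (n%:R * (2 * M * eta))%:E)%E &
    forall w, ~ B w -> forall k, (k < n)%N -> eta <= lam k w <= 1 - eta].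
Proof.
move=> eta0; elim: n => [|n [B [mB PB hB]]].
  by exists set0; split=> //; rewrite measure0 mul0r.
pose B1 := lam n @^-1` `[0, eta]; pose B2 := lam n @^-1` `[1 - eta, 1].
have mB1 : measurable B1 by exact: measurable_preimage_itv.
have mB2 : measurable B2 by exact: measurable_preimage_itv.
exists (B `|` (B1 `|` B2)); split; first by do 2! apply: measurableU => //.
  apply: le_trans (measureU2 _ _ _) _ => //; first exact: measurableU.
  rewrite -natr1 mulrDl EFinD mul1r; apply: leeD => //.
  apply: le_trans (measureU2 _ _ _) _ => //.
  have -> : (2 * M * eta)%:E = (M * (eta - 0))%:E + (M * (1 - (1 - eta)))%:E.
    by rewrite -EFinD; congr EFin; ring.
  by apply: leeD; apply: prob_itv_le; lra.
move=> w nB k; rewrite ltnS leq_eqVlt => /orP[/eqP->|]; last first.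
  by apply: hB => Bw; apply: nB; left.
have [/(_ w)/andP[l0 l1] _] := dens n.
apply/andP; split; rewrite leNgt; apply/negP => h; apply: nB; right.
  by left; rewrite /B1 /= in_itv /=; apply/andP; split; lra.
by right; rewrite /B2 /= in_itv /=; apply/andP; split; lra.
Qed.

End Probability.

(** * Union bound and Borel-Cantelli *)

Fixpoint words (n : nat) : seq word :=
  if n is n'.+1 then
    [::] :: [seq true :: s | s <- words n'] ++ [seq false :: s | s <- words n']
  else [:: [::]].

Lemma mem_words n (p : word) : (size p <= n)%N -> p \in words n.
Proof.
elim: n p => [|n IH] [|b p] //= hp.
by rewrite inE mem_cat; case: b; rewrite map_f ?IH ?orbT.
Qed.

Lemma size_words n : (size (words n) <= 2 ^ n.+1)%N.
Proof.
have : ((size (words n)).+1 = 2 ^ n.+1)%N; last by move=> <-.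
elim: n => //= n IH; rewrite size_cat !size_map expnS -IH.
by move: (size _) {IH} => k; lia.
Qed.

(** The events are handled through measurable covers, since closeness of a random Cantor set to a
    given output is an event whose measurability is never established. *)
Lemma measure_cover d (Omega : measurableType d) (R : realType)
    (P : probability Omega R) (I : eqType) (s : seq I) (S : I -> set Omega)
    (b : R) :
  (forall i, exists E, [/\ measurable E, S i `<=` E & (P E <= b%:E)%E]) ->
  exists E, [/\ measurable E, forall i, i \in s -> S i `<=` E &
    (P E <= ((size s)%:R * b)%:E)%E].
Proof.
move=> h; elim: s => [|i s [E [mE SE PE]]].
  by exists set0; split=> //; rewrite measure0 mul0r.
have [E' [mE' SE' PE']] := h i.
exists (E' `|` E); split; first exact: measurableU.
  move=> j; rewrite inE => /orP[/eqP-> w /SE'|/SE jE w /jE]; [by left|by right].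
apply: le_trans (measureU2 _ _ _) _ => //.
by rewrite /= -natr1 addrC mulrDl mul1r EFinD; exact: leeD.
Qed.

Theorem borel_cantelli_geometric d (Omega : measurableType d) (R : realType)
    (P : probability Omega R) (A : nat -> set Omega) (K : R) : 0 <= K ->
  (forall i, measurable (A i)) ->
  (forall i, (P (A i) <= (K * 2^-1 ^+ i)%:E)%E) ->
  {ae P, forall w, exists i0, forall i, (i0 <= i)%N -> ~ A i w}.
Proof.
move=> K0 mA PA; exists (lim_sup_set A); split.
- by apply: bigcapT_measurable => i; apply: bigcup_measurable => j _.
- apply: lim_sup_set_cvg0 => //.
  (* K 2^(-i) is rewritten in the shape of the geometric series bounded by [epsilon_trick0]. *)
  apply: (@le_lt_trans _ _ (\sum_(0 <= i <oo) (2 * K / (2 ^ i.+1)%:R)%:E)%E).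
    apply: lee_nneseries => [i _ _|i _]; first exact: measure_ge0.
    apply: le_trans (PA i) _; rewrite lee_fin natrX exprS exprVn.
    by rewrite le_eqVlt; apply/orP; left; apply/eqP; field; rewrite expf_neq0.
  apply: le_lt_trans (epsilon_trick0 _ _) (ltry _).
  by rewrite mulr_ge0.
move=> w hw i _; apply: contrapT => hn; apply: hw; exists i => j ij Aj.
by apply: hn; exists j.
Qed.

(** * Short programs fail at the scales eps_j *)

Section LowerBound.
Context d (Omega : measurableType d) (R : realType) (P : probability Omega R).
Variables (U : turing_machine) (lam : nat -> {RV P >-> R}) (f : R -> R) (M : R).
Hypotheses (indep : mutually_independent lam)
  (dens : forall k, has_density01 (lam k) f)
  (mf : measurable_fun (`]0, 1[%classic : set R) f)
  (f0 : forall x, 0 < x < 1 -> 0 <= f x) (fM : forall x, 0 < x < 1 -> f x <= M)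
  (M0 : 0 <= M).
Variable q : nat.
Hypothesis q2 : (2 <= q)%N.

Let t : R := 2^-1.
Let K w : set R := central_cantor (fun k => lam k w).

Let t01 : 0 <= t <= 1.
Proof. by rewrite /t; apply/andP; split; lra. Qed.

Let t_gt0 k : 0 < t ^+ k. Proof. by rewrite exprn_gt0 ?invr_gt0. Qed.

Let t_le k l : (k <= l)%N -> t ^+ l <= t ^+ k.
Proof. by move=> kl; apply: ler_wiXn2l; case/andP: t01. Qed.

(* Put Q = j^q.  Typical ratios are at least 2^(-qj), so
   the intervals of level j^(q-1) are longer than 2^(-(q+1)Q); the exponent
   leaves a precision 2^(-2Q) on each of the first j^(q-1) ratios. *)
Definition scale (j : nat) : R := 2^-1 ^+ ((2 * q + 4) * j ^ q).

Let typical j w := forall k, (k < j ^ q.-1)%N ->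
  t ^+ (q * j) <= lam k w <= 1 - t ^+ (q * j).

Let pow_q j : (j ^ q = j * j ^ q.-1)%N.
Proof. by rewrite -expnS prednK // ltnW. Qed.

Section Scale.
Variables (j : nat) (j0 : (0 < j)%N).

Let Q1 : (0 < j ^ q)%N. Proof. by rewrite expn_gt0 j0. Qed.

Let level_length_typical w : typical j w ->
  t ^+ (q.+1 * j ^ q) <= level_length (fun k => lam k w) (j ^ q.-1).
Proof.
move=> hw; apply: le_trans (@level_length_ge_expr _ _ (t ^+ (q * j)) _ _ _).
- rewrite -exprSr -exprM; apply: t_le.
  by rewrite mulSn mulSn pow_q; nia.
- exact/ltW.
- by move=> k /hw /andP[].
Qed.

(** If some typical [w0] is approximated by the output of [p], any other such [w] shares that
    output, so the two Cantor sets are within twice the scale and rigidity puts the ratios of [w] in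
    a box around those of [w0]. *)
Lemma program_box (p : word) : exists E : set Omega,
  [/\ measurable E,
   [set w | typical j w /\ exists F : seq rat, produces U p F /\
     (hausdorff_dist (@points R F) (K w) < (scale j)%:E)%E] `<=` E &
   (P E <= ((2 * M * t ^+ (2 * j ^ q)) ^+ (j ^ q.-1))%:E)%E].
Proof.
set S := [set w | _].
have [[w0 [typ0 [F0 [hF0 dF0]]]]|hS] := pselect (exists w, S w); last first.
  exists set0; split=> //; first by move=> w Sw; apply: hS; exists w.
  by rewrite measure0 lee_fin exprn_ge0 // mulr_ge0 ?mulr_ge0 // ltW.
have [mE PE] := prob_box_le indep dens mf f0 fM (j ^ q.-1)
  (fun k => lam k w0) (ltW (t_gt0 (2 * j ^ q))).
eexists; split; [exact: mE| |exact: PE].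
move=> w [typ [F [hF dF]]] k /=; rewrite mem_iota /= add0n => kn.
rewrite (produces_inj hF hF0) in dF.
have [a1 a2] := hausdorff_dist_lt dF; have [b1 b2] := hausdorff_dist_lt dF0.
have close (u v : Omega) :
    (forall x, K u x -> exists2 y, @points R F0 y & `|x - y| < scale j) ->
    (forall x, @points R F0 x -> exists2 y, K v y & `|x - y| < scale j) ->
    forall x, K u x -> exists2 y, K v y & `|x - y| < 2 * scale j.
  move=> h1 h2 x /h1[y /h2[z Kz yz] xy]; exists z => //.
  have -> : x - z = (x - y) + (y - z) by ring.
  by apply: le_lt_trans (ler_normD _ _) _; lra.
have typ_len := level_length_typical typ.
have Q3 : 6 * t ^+ (3 * j ^ q) <= 1.
  have : t ^+ (3 * j ^ q) <= t ^+ 3 by apply: t_le; lia.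
  by rewrite !exprS expr0 /t; lra.
have sc_small : 3 * (2 * scale j) <=
    t ^+ (q * j) * level_length (fun k => lam k w) (j ^ q.-1).
  apply: (@le_trans _ _ (t ^+ (q * j ^ q) * t ^+ (q.+1 * j ^ q))).
    rewrite /scale -/t -exprD.
    (* The part q pays for the margin 2^(-qj), q+1 for the interval length, and 3 absorbs the factor
       6. *)
    have -> : (2 * q + 4 = 3 + (q + q.+1))%N by clear; lia.
    by rewrite !mulnDl exprD; have := t_gt0 (q * j ^ q + q.+1 * j ^ q); nra.
  apply: ler_pM; [exact/ltW|exact/ltW| |exact: typ_len].
  by apply: t_le; rewrite leq_mul2l pow_q leq_pmulr ?orbT // expn_gt0 j0.
have w01 v i : 0 < lam i v < 1 by have [/(_ v)] := dens i.
have := @ratio_close R (fun i => lam i w) (fun i => lam i w0) (2 * scale j)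
  (t ^+ (q * j)) (j ^ q.-1) (fun i => w01 w i) (fun i => w01 w0 i).
have sc0 : 0 < scale j by exact: t_gt0.
move=> /(_ _ _ _ _ sc_small (close w w0 a1 b2) (close w0 w b1 a2) k kn).
have h1 i : (i < j ^ q.-1)%N -> lam i w <= 1 - t ^+ (q * j).
  by move=> /typ/andP[].
have h2 i : (i < j ^ q.-1)%N -> lam i w0 <= 1 - t ^+ (q * j).
  by move=> /typ0/andP[].
move=> /(_ (ltac:(lra)) (t_gt0 _) h1 h2) hk.
suff : 3 * (2 * scale j) / level_length (fun k => lam k w) (j ^ q.-1) <=
    t ^+ (2 * j ^ q).
  move=> /(lt_le_trans hk); rewrite in_itv /= ltr_norml => /andP[h3 h4].
  by apply/andP; split; lra.
have len0 := lt_le_trans (t_gt0 _) typ_len.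
rewrite ler_pdivrMr //.
apply: (@le_trans _ _ (t ^+ (2 * j ^ q) * t ^+ (q.+1 * j ^ q))); last first.
  by rewrite ler_pM2l.
rewrite /scale -/t -exprD.
(* One q+1 cancels the length in the denominator, 2 is the precision reached, and the other q+1 >= 3
   absorbs the factor 6. *)
have -> : (2 * q + 4 = q.+1 + (2 + q.+1))%N by clear; lia.
rewrite !mulnDl exprD; set y := t ^+ (2 * j ^ q + _).
have : t ^+ (q.+1 * j ^ q) <= t ^+ (3 * j ^ q).
  by apply: t_le; rewrite leq_mul2r ltnS q2 orbT.
have : 0 < y by exact: t_gt0.
move: Q3; move: (t ^+ (3 * _)) (t ^+ (q.+1 * _)) => a b; nra.
Qed.

(** With n = j^(q-1) and Q = j^q: extreme ratios cost 2M n 2^(-qj) <= 2M 2^(-j), because n <=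
    2^((q-1)j). The boxes cost 2^(nQ+1) (2M 2^(-2Q))^n = 2 (2M 2^(-Q))^n <= 2 * 2^(-n), because 4M
    <= 2^j <= 2^Q, and n >= j. *)
Lemma atypical_event : 4 * M <= 2 ^+ j -> exists A : set Omega,
  [/\ measurable A, (P A <= ((2 * M + 2) * t ^+ j)%:E)%E &
    forall w, ~ A w -> forall p F, (size p <= j ^ q.-1 * j ^ q)%N ->
      produces U p F ->
      ~ (hausdorff_dist (@points R F) (K w) < (scale j)%:E)%E].
Proof.
move=> hM.
have [B [mB PB hB]] := prob_atypical_le dens mf f0 fM (j ^ q.-1)
  (ltW (t_gt0 (q * j))).
have [E [mE hE PE]] := measure_cover (words (j ^ q.-1 * j ^ q)) program_box.
exists (B `|` E); split; first exact: measurableU.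
- apply: le_trans (measureU2 _ _ _) _ => //.
  rewrite mulrDl EFinD; apply: leeD.
    apply: le_trans PB _; rewrite lee_fin.
    have : (j ^ q.-1)%:R * t ^+ (q * j) <= t ^+ j.
      have -> : (q * j = q.-1 * j + j)%N by rewrite -mulSnr prednK // ltnW.
      rewrite exprD mulrA ler_piMl ?(ltW (t_gt0 _)) //.
      rewrite /t exprVn ler_pdivrMr ?exprn_gt0 //.
      rewrite mul1r -natrX ler_nat mulnC expnM.
      have q10 : (0 < q.-1)%N by lia.
      by rewrite (leq_exp2r _ _ q10) ltnW // ltn_expl.
    move: (t ^+ j) (t ^+ (q * j)) (_%:R) => a b c.
    by move=> /(ler_wpM2l M0); lra.
  apply: le_trans PE _; rewrite lee_fin.
  have c0 : 0 <= 2 * M * t ^+ (2 * j ^ q) by rewrite !mulr_ge0 // ltW.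
  have M2 : 2 * M * t ^+ (j ^ q) <= t.
    have : t ^+ (j ^ q) <= t ^+ j.
      by apply: t_le; rewrite pow_q leq_pmulr // expn_gt0 j0.
    have : t ^+ j * 2 ^+ j = 1 by rewrite -exprMn /t mulVf ?expr1n ?pnatr_eq0.
    have := t_gt0 j; move: hM; rewrite /t; move: M0.
    move: (_ ^+ (j ^ q)) (_ ^+ j) (2 ^+ j) => a b c; nra.
  apply: (@le_trans _ _ (2 ^+ (j ^ q.-1 * j ^ q).+1 *
      (2 * M * t ^+ (2 * j ^ q)) ^+ (j ^ q.-1))).
    apply: ler_wpM2r; first exact: exprn_ge0.
    by rewrite -natrX ler_nat size_words.
  rewrite exprS -mulrA ler_pM2l // mulnC exprM -exprMn.
  apply: (@le_trans _ _ (t ^+ (j ^ q.-1))).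
    apply: lerXn2r; rewrite ?nnegrE; [exact: mulr_ge0|by case/andP: t01|].
    apply: le_trans M2; rewrite mul2n -addnn exprD.
    have h : 2 ^+ (j ^ q) * t ^+ (j ^ q) = 1.
      by rewrite -exprMn /t mulfV ?expr1n ?pnatr_eq0.
    by rewrite mulrCA [2 ^+ _ * (_ * _)]mulrA h mul1r.
  apply: t_le; rewrite -{1}(expn1 j) leq_pexp2l //; lia.
move=> w nAw p F hp pF dF; apply: nAw.
have [Bw|nBw] := pselect (B w); first by left.
right; apply: (hE p (mem_words hp)); split; last by exists F.
exact: hB nBw.
Qed.

End Scale.

Lemma few_good_programs : {ae P, forall w, exists j1, forall j, (j1 <= j)%N ->
  forall p F, (size p <= j ^ q.-1 * j ^ q)%N -> produces U p F ->
    ~ (hausdorff_dist (@points R F) (K w) < (scale j)%:E)%E}.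
Proof.
pose j0 := (Num.truncn (4 * M)).+1.
have hj0 i : 4 * M <= 2 ^+ (i + j0).
  have M4 : 0 <= 4 * M by move: M0; lra.
  have /andP[_ h] := truncn_itv M4.
  apply: le_trans (ltW h) _; rewrite -natrX ler_nat -/j0.
  by apply: leq_trans (leq_addl i j0) _; rewrite ltnW // ltn_expl.
have /choice[A hA] : forall i : nat, exists A : set Omega,
    [/\ measurable A, (P A <= ((2 * M + 2) * t ^+ (i + j0))%:E)%E &
      forall w, ~ A w -> forall p F,
      (size p <= (i + j0) ^ q.-1 * (i + j0) ^ q)%N -> produces U p F ->
      ~ (hausdorff_dist (@points R F) (K w) < (scale (i + j0))%:E)%E].
  by move=> i; apply: atypical_event => //; rewrite addnS.
have bc := @borel_cantelli_geometric _ _ _ P A (2 * M + 2) _ _ _.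
apply: filterS (bc _ _ _) => [w [i0 hi0]||i|i].
- exists (i0 + j0)%N => j hj; have [_ _] := hA (j - j0)%N.
  rewrite subnK; last by lia.
  by apply; apply: hi0; lia.
- by move: M0; lra.
- by have [] := hA i.
have [_ hP _] := hA i; apply: le_trans hP _; rewrite lee_fin ler_wpM2l //.
  by move: M0; lra.
by apply: t_le; exact: leq_addr.
Qed.

End LowerBound.

(** * From the scales to all small eps *)

Lemma Delta_ge (R : realType) U (K : set R) (eps eps' : R) (L : nat) :
  eps <= eps' ->
  (forall p F, (size p <= L)%N -> produces U p F ->
     ~ (hausdorff_dist (@points R F) K < eps'%:E)%E) ->
  (L%:R%:E <= Delta U K eps)%E.
Proof.
move=> ee' h; apply: le_ereal_inf_tmp => _ [p [F [hp hF]] <-].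
rewrite lee_fin ler_nat leqNgt; apply/negP => /ltnW pL.
by apply: (h p F pL hp); apply: lt_le_trans hF _; rewrite lee_fin.
Qed.

(** Take the largest j with eps <= eps_j. Then eps > eps_(j+1), so log(1/eps) is at most s (j+1)^q
    <= s (2j)^q. *)
Lemma scale_interpolation (R : realType) (q j1 : nat) : (0 < q)%N ->
  let s : R := (2 * q + 4)%:R * ln 2 in
  \forall eps \near 0^'+, 1 <= ln eps^-1 /\
    exists j, [/\ (j1 <= j)%N, eps <= scale R q j &
      ln eps^-1 <= s * (2 * j%:R) ^+ q].
Proof.
move=> q0 s.
have ln2 : 0 < ln 2 :> R by rewrite ln_gt0 // ltr1n.
have s0 : 0 < s by rewrite mulr_gt0 // ltr0n addn_gt0 orbT.
have scaleE j : scale R q j = expR (- (s * (j ^ q)%:R)).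
  rewrite /scale -[2^-1]lnK ?posrE ?invr_gt0 // -expRM_natl lnV ?posrE //.
  by congr expR; rewrite natrM /s; ring.
near=> eps.
have e0 : 0 < eps by near: eps; exact: nbhs_right_gt.
have e1 : eps < expR (-1) by near: eps; apply: nbhs_right_lt; exact: expR_gt0.
have e2 : eps < scale R q j1.+1.
  by near: eps; apply: nbhs_right_lt; rewrite scaleE expR_gt0.
have lnE : ln eps^-1 = - ln eps by rewrite lnV ?posrE.
have lePscale j : (s * (j ^ q)%:R <= ln eps^-1) = (eps <= scale R q j).
  by rewrite lnE scaleE -{2}[eps]lnK ?posrE // ler_expR lerNr.
split.
  rewrite lnE lerNr -[X in _ <= X]expRK.
  by rewrite ler_ln ?posrE ?expR_gt0 // ltW.
pose Pj j := s * (j ^ q)%:R <= ln eps^-1.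
have exP : exists j, Pj j by exists j1.+1; rewrite /Pj lePscale ltW.
have bndP j : Pj j -> (j <= Num.truncn (ln eps^-1 / s))%N.
  move=> hj; have h : j%:R <= ln eps^-1 / s.
    rewrite ler_pdivlMr // mulrC; apply: le_trans hj.
    rewrite ler_pM2l // ler_nat; case: j => // j.
    by rewrite -{1}(expn1 j.+1) leq_pexp2l.
  by rewrite truncn_ge_nat // (le_trans _ h).
case: (ex_maxnP exP bndP) => j hj jmax.
(* Starting from [j1.+1] also ensures j >= 1, needed for j + 1 <= 2j. *)
have jj1 : (j1.+1 <= j)%N by apply: jmax; rewrite /Pj lePscale ltW.
exists j; split; [exact: ltnW|by rewrite -lePscale|].
have : ~~ Pj j.+1 by apply/negP => /jmax; rewrite ltnn.
rewrite /Pj -ltNge => /ltW h; apply: le_trans h _.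
rewrite ler_pM2l // natrX; apply: lerXn2r; rewrite ?nnegrE ?mulr_ge0 //.
by rewrite -natrM ler_nat; lia.
Unshelve. all: by end_near.
Qed.

Unset Implicit Arguments.

Theorem theorem2p3 (R : realType) (U : turing_machine) (U_univ : universal U) :
  (forall lam : nat -> R, (forall k, 0 < lam k < 1) ->
     preccurlyeq (Delta U (central_cantor lam))
                 (fun eps => (ln (eps^-1) ^+ 2)%:E)) /\
  (forall (d : measure_display) (Omega : measurableType d)
          (P : probability Omega R) (lam : nat -> {RV P >-> R}) (f : R -> R)
          (m M : R),
     mutually_independent lam ->
     (forall k, has_density01 (lam k) f) ->
     measurable_fun (`]0, 1[%classic : set R) f ->
     0 < m ->
     (forall x, 0 < x < 1 -> m <= f x <= M) ->
     forall delta : R, 0 < delta ->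
     {ae P, forall w : Omega,
        preccurlyeq (fun eps => (ln (eps^-1) `^ (2 - delta))%:E)
                    (Delta U (central_cantor (fun k => lam k w)))}).
Proof.
split=> [lam lam01|]; first exact: Delta_cantor_upper_bound.
move=> d Omega P lam f m M indep dens mf m0 fmM delta delta0.
have f0 x : 0 < x < 1 -> 0 <= f x.
  by move=> /fmM/andP[mfx _]; exact: le_trans (ltW m0) mfx.
have fM x : 0 < x < 1 -> f x <= M by move=> /fmM/andP[].
have M0 : 0 <= M.
  pose x : R := 2^-1; have h : 0 < x < 1 by apply/andP; split; rewrite /x; lra.
  exact: le_trans (f0 _ h) (fM _ h).
have [q q2 hq] : exists2 q, (2 <= q)%N & q%:R^-1 <= delta.
  exists (Num.truncn delta^-1).+2 => //.
  have d0 : 0 <= delta^-1 by rewrite invr_ge0 ltW.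
  have /andP[_ h] := truncn_itv d0.
  rewrite -[leRHS]invrK lef_pV2 ?posrE ?invr_gt0 //.
  by apply: le_trans (ltW h) _; rewrite ler_nat.
have q0 : 0 < q%:R :> R by rewrite ltr0n ltnW.
have q1 : q%:R^-1 <= 1 :> R by rewrite invf_le1 // ler1n ltnW.
pose s : R := (2 * q + 4)%:R * ln 2.
have s0 : 0 < s by rewrite mulr_gt0 ?ln_gt0 ?ltr1n // ltr0n addn_gt0 orbT.
(* This exponent is at least 2 - delta, and satisfies qr = 2q - 1, so that (j^q)^r is exactly the
   program length j^(q-1) j^q. *)
pose r : R := 2 - q%:R^-1.
have r0 : 0 <= r by rewrite /r; lra.
have c0 : 0 <= s * 2 ^+ q by rewrite mulr_ge0 ?exprn_ge0 // ltW.
apply: filterS (few_good_programs U indep dens mf f0 fM M0 q2) => w [j1 hj1].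
exists ((s * 2 ^+ q) `^ r); first by rewrite powR_gt0 // mulr_gt0 // exprn_gt0.
have := @scale_interpolation R q j1 (ltnW q2).
apply: filterS => eps [X1 [j [jj1 ej hX]]].
have hD := Delta_ge ej (hj1 j jj1).
apply: le_trans (lee_wpmul2l _ hD); last by rewrite lee_fin powR_ge0.
rewrite -EFinM lee_fin.
apply: (@le_trans _ _ (ln eps^-1 `^ r)).
  by apply: ler_powR => //; rewrite /r; lra.
apply: (@le_trans _ _ ((s * 2 ^+ q * j%:R ^+ q) `^ r)).
  apply: ge0_ler_powR; rewrite ?nnegrE //.
  - exact: le_trans ler01 X1.
  - by rewrite mulr_ge0 // exprn_ge0.
  - by rewrite -mulrA -exprMn.
rewrite powRM ?exprn_ge0 //.
rewrite ler_wpM2l ?powR_ge0 //.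
rewrite -powR_mulrn // -powRrM.
have -> : q%:R * r = (q.-1 + q)%:R.
  by rewrite /r natrD -subn1 natrB 1?ltnW // mulrBr divff ?gt_eqF //; ring.
by rewrite powR_mulrn // -natrX expnD.
Qed.
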